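(* Let $\mathcal X$ be a compact metric space satisfying the shrinking assumption (A) given in the context. Let $\mu\in\mathcal P(\mathcal X\times\{0,1\})$ be a probability measure, $\varrho_i:=\mu(\,\cdot\,\times\{i\})$ for $i\in\{0,1\}$, and let $u\in C_0(\mathcal X)$ $(=C(\mathcal X))$. Then a finite signed Radon measure $\mu^*$ satisfies $\mu^*\in\partial\mathrm{TV}_\varepsilon(u)$ if and only if there exists a pair of random walks $\underline{\mathbf m}=(\mathbf m^0,\mathbf m^1)\in RW(\mathcal X)\times RW(\mathcal X)$ such that $\mathrm{supp}\,m^i_x\subset\overline{\mathrm B}_\varepsilon(x)$ for $\varrho$-a.e. $x\in\mathcal X$ and $i\in\{0,1\}$, $$\mu^*=-\mathrm{div}_\varepsilon^{\boldsymbol\varrho}[\underline{\mathbf m}]\qquad\text{and}\qquad \mathrm{TV}_\varepsilon(u)=\int_{\mathcal X}u\,\mathrm d\mu^*.$$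
   Context: Fix $\varepsilon>0$; $\overline{\mathrm B}_r(x)=\{y\in\mathcal X:\mathrm d(x,y)\le r\}$. Assumption (A): for every $x\in\mathcal X$ and $0<r<\varepsilon$ there is a measurable map $T_{x,r}:\overline{\mathrm B}_\varepsilon(x)\to\overline{\mathrm B}_{\varepsilon-r}(x)$ with $\mathrm d(T_{x,r}(y),y)\le r$ for all $y\in\overline{\mathrm B}_\varepsilon(x)$. Put $\varrho:=\varrho_0+\varrho_1$, $\boldsymbol\varrho=(\varrho_0,\varrho_1)$. For $u\in C(\mathcal X)$, $$\mathrm{TV}_\varepsilon(u)=\int_{\mathcal X}\frac{\max_{\overline{\mathrm B}_\varepsilon(x)}u-u(x)}{\varepsilon}\,\mathrm d\varrho_0(x)+\int_{\mathcal X}\frac{u(x)-\min_{\overline{\mathrm B}_\varepsilon(x)}u}{\varepsilon}\,\mathrm d\varrho_1(x).$$ The subdifferential is taken in $C_0(\mathcal X)^*$, identified with the space $\mathcal M_f^\pm(\mathcal X)$ of finite signed Radon measures: $\mu^*\in\partial\mathrm{TV}_\varepsilon(u)$ iff $\mathrm{TV}_\varepsilon(u)+\int_{\mathcal X}(v-u)\,\mathrm d\mu^*\le\mathrm{TV}_\varepsilon(v)$ for all $v\in C_0(\mathcal X)$. A random walk $\mathbf m\in RW(\mathcal X)$ is a family $(m_x)_{x\in\mathcal X}$ of Borel probability measures on $\mathcal X$ such that (i) for all Borel $A\subset\mathcal X$ and Borel $B\subset\mathbb R$ the set $\{x:m_x(A)\in B\}$ is Borel; (ii) for some $x_0\in\mathcal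 X$ and all $x\in\mathcal X$, $\int_{\mathcal X}\mathrm d(x_0,y)\,\mathrm dm_x(y)<\infty$. Nonlocal weighted divergence: for Borel $A\subset\mathcal X$, $$\mathrm{div}_\varepsilon^{\varrho_i}[\mathbf m](A)=\frac1\varepsilon\Big(\int_A m_x(\mathcal X)\,\mathrm d\varrho_i(x)-\int_{\mathcal X}m_x(A)\,\mathrm d\varrho_i(x)\Big),\qquad \mathrm{div}_\varepsilon^{\boldsymbol\varrho}[\underline{\mathbf m}]:=\mathrm{div}_\varepsilon^{\varrho_0}[\mathbf m^0]-\mathrm{div}_\varepsilon^{\varrho_1}[\mathbf m^1].$$ *)

(* Defs.v *)
From HB Require Import structures.
From mathcomp Require Import all_boot all_order all_algebra.
From mathcomp Require Import all_classical all_reals all_analysis.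

Set Implicit Arguments.
Unset Strict Implicit.
Unset Printing Implicit Defensive.

Import Order.TTheory GRing.Theory Num.Theory.
Import numFieldNormedType.Exports.

Local Open Scope classical_set_scope.
Local Open Scope ring_scope.

(* Metric spaces with a distinguished point: [measurableType] is pointed in the
   library. The point plays no other role, and costs no generality here since a
   space carrying a probability measure is nonempty. *)
#[short(type="pmetricType")]
HB.structure Definition PMetric (K : numDomainType) :=
  { M of Metric K M & isPointed M }.

Notation borel X := (g_sigma_algebraType (@open X)).

Section metric_space.
Context {R : realType} {X : pmetricType R}.
Implicit Types (x y : X) (r eps : R) (u : X -> R).

(* Not the library's [closed_ball], which is the closure of the open ball and
   can be strictly smaller. *)
Definition cball x r : set X := [set y | mdist x y <= r].

Definition shrinking eps := forall x r, 0 < r < eps ->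
  exists T : borel X -> borel X,
    [/\ measurable_fun (cball x eps : set (borel X)) T,
        forall y, cball x eps y -> cball x (eps - r) (T y) &
        forall y, cball x eps y -> mdist (T y : X) y <= r].

(* On a compact space these are attained for continuous [u]; see [ball_maxP]
   and [ball_minP]. *)
Definition ball_max eps u x : R := sup (u @` cball x eps).
Definition ball_min eps u x : R := inf (u @` cball x eps).

Lemma cball_closed x r : closed (cball x r).
Proof.
move=> y Py; rewrite /cball/= leNgt; apply/negP => rxy.
have e0 : 0 < mdist x y - r by rewrite subr_gt0.
have [z [xz]] := Py _ (nbhsx_ballx y _ e0); rewrite ballEmdist/= => yz.
have := metric_triangle x z y; rewrite leNgt => /negP; apply.
by rewrite (metric_sym z) -(subrK r (mdist x y)) addrC ltr_leD.
Qed.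

Let cball_compact x r : compact [set: X] -> compact (cball x r).
Proof.
by move=> cX; apply: (subclosed_compact _ cX) => //; exact: cball_closed.
Qed.

Let cball_neq0 x r : 0 < r -> cball x r !=set0.
Proof. by move=> r0; exists x; rewrite /cball/= mdistxx ltW. Qed.

Lemma ball_maxP eps u x : 0 < eps -> compact [set: X] -> continuous u ->
  exists2 y, cball x eps y & ball_max eps u x = u y /\
    forall z, cball x eps z -> u z <= u y.
Proof.
move=> e0 cX cu.
have [y] := compact_EVT_max (@cball_neq0 x eps e0) (@cball_compact x eps cX)
  (continuous_subspaceT cu).
rewrite inE => xy ymax; exists y => //; split; last first.
  by move=> z xz; apply: ymax; rewrite inE.
apply/eqP; rewrite eq_le; apply/andP; split.
  apply: ge_sup; first by exists (u y), y.
  by move=> _ [z xz <-]; apply: ymax; rewrite inE.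
apply: ub_le_sup; last by exists y.
by exists (u y) => _ [z xz <-]; apply: ymax; rewrite inE.
Qed.

Lemma ball_minP eps u x : 0 < eps -> compact [set: X] -> continuous u ->
  exists2 y, cball x eps y & ball_min eps u x = u y /\
    forall z, cball x eps z -> u y <= u z.
Proof.
move=> e0 cX cu.
have [y] := compact_EVT_min (@cball_neq0 x eps e0) (@cball_compact x eps cX)
  (continuous_subspaceT cu).
rewrite inE => xy ymin; exists y => //; split; last first.
  by move=> z xz; apply: ymin; rewrite inE.
apply/eqP; rewrite eq_le; apply/andP; split.
  apply: ge_inf; last by exists y.
  by exists (u y) => _ [z xz <-]; apply: ymin; rewrite inE.
apply: lb_le_inf; first by exists (u y), y.
by move=> _ [z xz <-]; apply: ymin; rewrite inE.
Qed.

Definition msupp (m : set (borel X) -> \bar R) : set X :=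
  [set x | forall U : set X, open U -> U x -> (0 < m U)%E].

End metric_space.

Arguments shrinking {R} X eps.

(* The labels 0 and 1 are [false] and [true]. *)
Section labelled_measures.
Context {R : realType} {d} {T : measurableType d}.
Variable mu : probability (T * bool)%type R.

Definition rho_ (i : bool) (A : set T) : \bar R := mu (A `*` [set i]).

Section instances.
Variable i : bool.

Let rho_0 : rho_ i set0 = 0%E.
Proof. by rewrite /rho_ set0X measure0. Qed.

Let rho_ge0 A : (0 <= rho_ i A)%E.
Proof. exact: measure_ge0. Qed.

Let rho_sigma_additive : semi_sigma_additive (rho_ i).
Proof.
move=> F mF tF mUF; rewrite /rho_ setX_bigcupl.
apply: measure_semi_sigma_additive.
- by move=> n; apply: measurableX.
- apply/trivIsetP => j k _ _ jk; rewrite -setXI.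
  by move/trivIsetP : tF => /(_ j k Logic.I Logic.I jk) ->; rewrite set0X.
- by rewrite -setX_bigcupl; exact: measurableX.
Qed.

HB.instance Definition _ := isMeasure.Build _ _ _ (rho_ i)
  rho_0 rho_ge0 rho_sigma_additive.

Let rho_finite : fin_num_fun (rho_ i).
Proof. by move=> A mA; apply: fin_num_measure; exact: measurableX. Qed.

HB.instance Definition _ := @Measure_isFinite.Build _ _ _ (rho_ i) rho_finite.

End instances.

Definition rho := measure_add (rho_ false) (rho_ true).

End labelled_measures.

Section charge_integral.
Context {R : realType} {d} {T : measurableType d}.
Variable nu : {charge set T -> \bar R}.

Let exN := cid (Hahn_decomposition nu).
Let nuPN := svalP (cid (svalP exN)).

(* Integral of [f] against the Jordan decomposition of [nu]; the choice of the
   Hahn decomposition is irrelevant by [Hahn_decomposition_uniq]. *)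
Definition charge_Rintegral (f : T -> R) : R :=
  \int[jordan_pos nuPN]_x f x - \int[jordan_neg nuPN]_x f x.

End charge_integral.

Section total_variation.
Context {R : realType} {X : pmetricType R}.

Definition TV (eps : R) (mu : probability (borel X * bool)%type R)
    (u : X -> R) : R :=
  \int[rho_ mu false]_x ((ball_max eps u x - u x) / eps) +
  \int[rho_ mu true]_x ((u x - ball_min eps u x) / eps).

(* The space is compact in all uses, so that C_0(X) = C(X), and every finite
   signed Borel measure, i.e., every charge on [borel X], is Radon. *)
Definition subdifferential (F : (X -> R) -> R) (u : X -> R) :
    set ({charge set (borel X) -> \bar R}) :=
  [set nu | forall v : X -> R, continuous v ->
    F u + charge_Rintegral nu (fun x : borel X => v x - u x) <= F v].

Definition random_walk (m : R.-pker (borel X) ~> (borel X)) :=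
  exists x0 : X, forall x, (\int[m x]_y (mdist x0 y)%:E < +oo)%E.

Definition divergence (eps : R) (r : {measure set (borel X) -> \bar R})
    (m : R.-pker (borel X) ~> (borel X)) (A : set (borel X)) : \bar R :=
  ((eps^-1)%:E *
    (\int[r]_(x in A) m x [set: borel X] - \int[r]_x m x A))%E.

Definition divergence2 (eps : R) (mu : probability (borel X * bool)%type R)
    (m0 m1 : R.-pker (borel X) ~> (borel X)) (A : set (borel X)) : \bar R :=
  (divergence eps (rho_ mu false) m0 A - divergence eps (rho_ mu true) m1 A)%E.

End total_variation.

(* Main.v *)
(* The inequality TV(u) + <mu*, v - u> <= TV(v) for all v amounts, TV being
   sublinear, to <mu*, u> = TV(u) and <mu*, v> <= TV(v) for all v.  The latter
   says that M(v) = eps <mu*, v> + int v drho_0 - int v drho_1 is dominated by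
   int max_B(x) v drho_0 - int min_B(x) v drho_1, and what has to be shown is a
   Strassen theorem: M(v) = int int v dm0_x drho_0 - int int v dm1_x drho_1
   with m0_x, m1_x carried by the ball B(x).

   By Hahn-Banach, v |-> M(v), seen on the functions ((x,i),y) |-> (-1)^i v(y),
   is extended to a functional L on the bounded functions on (X x {0,1}) x X
   that is positive with respect to the order on { d(x,y) <= eps } and extends
   the integral against mu.  For C in X, the set function
   A |-> L(1_A 1_C) is a measure dominated by mu, hence has a density.  Taking
   for C the nested cylinders of a coding of X by binary sequences (X is a
   continuous image of the Cantor space), these densities at w = (x,i) are the
   masses of a probability on the binary tree; it is realised as the law of the
   branch selected by a uniform variable, which avoids the Riesz representation
   theorem, and its image in X is the kernel at w. *)

From HB Require Import structures.
Require Import Defs.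
From mathcomp Require Import all_boot all_order all_algebra.
From mathcomp Require Import all_classical all_reals all_analysis.
From mathcomp Require Import measurable_realfun.
From mathcomp Require Import lra ring.

Set Implicit Arguments.
Unset Strict Implicit.
Unset Printing Implicit Defensive.

Import Order.TTheory GRing.Theory Num.Theory.
Import numFieldNormedType.Exports.

Local Open Scope classical_set_scope.
Local Open Scope ring_scope.

(** * Bounded measurable functions *)

(** For a single v, a maximiser in each ball would do, but the walks may not depend on v; the
    maximisers for all v have to be replaced by one choice, and this is what Hahn-Banach provides.
    Its price is an extension L to arbitrary bounded functions of (w, y), where no countable
    additivity comes with it. Everything is recovered from one inequality: L phi is at most the
    integral of every bounded measurable psi(w) that majorises phi(w, y) over the ball at w. Used
    for phi and for -phi, it fixes L on functions of w alone and makes L vanish on functions that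
    vanish at all pairs with d(x,y) <= eps. Domination by mu then upgrades finite additivity of A
    |-> L(1_A 1_C) to countable additivity, and no continuity of L in the variable y is ever
    required: for continuous v, approximation by step functions on cylinders is uniform. *)

Section bounded_measurable.
Context {R : realType} {d} {T : measurableType d}.
Implicit Types (f g : T -> R) (D : set T).

(** Such functions are integrable against every finite measure, which makes real-valued integrals
    linear and monotone with no further side condition. *)
Definition bmeas f := measurable_fun [set: T] f /\ exists C : R, forall x, `|f x| <= C.

Lemma bmeas_cst r : bmeas (cst r).
Proof. by split; [exact: measurable_cst|exists `|r|]. Qed.

Lemma bmeasD f g : bmeas f -> bmeas g -> bmeas (fun x => f x + g x).
Proof.
move=> [mf [C fC]] [mg [C' gC]]; split; first exact: measurable_funD.
by exists (C + C') => x; rewrite (le_trans (ler_normD _ _))// lerD.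
Qed.

Lemma bmeasM f g : bmeas f -> bmeas g -> bmeas (fun x => f x * g x).
Proof.
move=> [mf [C fC]] [mg [C' gC]]; split; first exact: measurable_funM.
by exists (C * C') => x; rewrite normrM ler_pM.
Qed.

Lemma bmeasZ r f : bmeas f -> bmeas (fun x => r * f x).
Proof. by apply: bmeasM; exact: bmeas_cst. Qed.

Lemma bmeasN f : bmeas f -> bmeas (fun x => - f x).
Proof.
by move=> /(bmeasZ (-1)); under eq_fun do rewrite mulN1r.
Qed.

Lemma bmeasB f g : bmeas f -> bmeas g -> bmeas (fun x => f x - g x).
Proof. by move=> bf /bmeasN; exact: bmeasD. Qed.

Lemma bmeas_indic D : measurable D -> bmeas (\1_D : T -> R).
Proof.
move=> mD; split; first exact: measurable_indic.
by exists 1 => x; rewrite indicE; case: (_ \in _); rewrite ?normr1 ?normr0.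
Qed.

Lemma bmeas_sum (I : Type) (s : seq I) (F : I -> T -> R) :
  (forall i, bmeas (F i)) -> bmeas (fun x => \sum_(i <- s) F i x).
Proof.
move=> bF; elim: s => [|i s IH].
  by under eq_fun do rewrite big_nil; exact: bmeas_cst.
by under eq_fun do rewrite big_cons; exact: bmeasD.
Qed.

Lemma bmeas_max f g : bmeas f -> bmeas g -> bmeas (fun x => Num.max (f x) (g x)).
Proof.
move=> [mf [C fC]] [mg [C' gC]]; split; first exact: measurable_maxr.
exists (Num.max C C') => x; rewrite maxEle le_max; case: ifP => _; by rewrite ?fC ?gC ?orbT.
Qed.

Section Rintegral.
Variable mu : {measure set T -> \bar R}.
Hypothesis fmu : (mu [set: T] < +oo)%E.

Lemma bmeas_integrable D f : measurable D -> bmeas f ->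
  mu.-integrable D (EFin \o f).
Proof.
move=> mD [mf [C fC]]; apply: measurable_bounded_integrable => //.
- by apply: le_lt_trans fmu; apply: le_measure; rewrite ?inE.
- exact: measurable_funTS.
- exists C; split; first exact: num_real.
  by move=> M CM x _; exact: le_trans (fC x) (ltW CM).
Qed.

Lemma bmeas_EFin D f : measurable D -> bmeas f ->
  (\int[mu]_(x in D) f x)%:E = (\int[mu]_(x in D) (f x)%:E)%E.
Proof.
move=> mD bf; rewrite /Rintegral fineK//.
by apply: integrable_fin_num => //; exact: bmeas_integrable.
Qed.

Lemma bmeas_RintegralD D f g : measurable D -> bmeas f -> bmeas g ->
  \int[mu]_(x in D) (f x + g x) = \int[mu]_(x in D) f x + \int[mu]_(x in D) g x.
Proof. by move=> mD bf bg; rewrite RintegralD//; exact: bmeas_integrable. Qed.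

Lemma bmeas_RintegralZ D r f : measurable D -> bmeas f ->
  \int[mu]_(x in D) (r * f x) = r * \int[mu]_(x in D) f x.
Proof. by move=> mD bf; rewrite RintegralZl//; exact: bmeas_integrable. Qed.

Lemma bmeas_RintegralB D f g : measurable D -> bmeas f -> bmeas g ->
  \int[mu]_(x in D) (f x - g x) = \int[mu]_(x in D) f x - \int[mu]_(x in D) g x.
Proof. by move=> mD bf bg; rewrite RintegralB//; exact: bmeas_integrable. Qed.

Lemma bmeas_RintegralN D f : measurable D -> bmeas f ->
  \int[mu]_(x in D) (- f x) = - \int[mu]_(x in D) f x.
Proof.
move=> mD bf; under eq_Rintegral do rewrite -mulN1r.
by rewrite bmeas_RintegralZ// mulN1r.
Qed.

Lemma bmeas_Rintegral_sum D (I : Type) (s : seq I) (F : I -> T -> R) :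
  measurable D -> (forall i, bmeas (F i)) ->
  \int[mu]_(x in D) (\sum_(i <- s) F i x) = \sum_(i <- s) \int[mu]_(x in D) F i x.
Proof.
move=> mD bF; elim: s => [|i s IH].
  under eq_Rintegral do rewrite big_nil.
  by rewrite big_nil Rintegral_cst// mul0r.
under eq_Rintegral do rewrite big_cons.
by rewrite bmeas_RintegralD// ?IH ?big_cons//; exact: bmeas_sum.
Qed.

Lemma bmeas_le_Rintegral D f g : measurable D -> bmeas f -> bmeas g ->
  (forall x, D x -> f x <= g x) ->
  \int[mu]_(x in D) f x <= \int[mu]_(x in D) g x.
Proof. by move=> mD bf bg; apply: le_Rintegral => //; exact: bmeas_integrable. Qed.

(** [g] equals [max f g] almost everywhere on [D], and the latter dominates [f] at every point. *)
Lemma bmeas_le_Rintegral_ae D f g : measurable D -> bmeas f -> bmeas g ->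
  {ae mu, forall x, D x -> f x <= g x} ->
  \int[mu]_(x in D) f x <= \int[mu]_(x in D) g x.
Proof.
move=> mD bf bg fg.
have bm := bmeas_max bf bg.
have -> : \int[mu]_(x in D) g x = \int[mu]_(x in D) Num.max (f x) (g x).
  congr fine; apply: ae_eq_integral => //.
  - by apply/measurable_EFinP; apply: measurable_funTS; case: bg.
  - by apply/measurable_EFinP; apply: measurable_funTS; case: bm.
  - by apply: filterS fg => x fgx Dx; rewrite max_r// fgx.
by apply: bmeas_le_Rintegral => // x _; rewrite le_max lexx.
Qed.

Lemma Rintegral_indic D E : measurable D -> measurable E ->
  \int[mu]_(x in D) \1_E x = fine (mu (E `&` D)).
Proof. by move=> mD mE; rewrite /Rintegral integral_indic. Qed.

End Rintegral.

Lemma bmeas_Rintegral_add (mu nu : {measure set T -> \bar R}) f :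
  (mu [set: T] < +oo)%E -> (nu [set: T] < +oo)%E -> bmeas f ->
  \int[measure_add mu nu]_x f x = \int[mu]_x f x + \int[nu]_x f x.
Proof.
move=> fmu fnu bf; rewrite /Rintegral.
have imu := bmeas_integrable fmu measurableT bf.
have inu := bmeas_integrable fnu measurableT bf.
by rewrite integral_measure_add// fineD//; exact: integrable_fin_num.
Qed.

Lemma bmeas_Rintegral_scale (r : {nonneg R}) (mu : {measure set T -> \bar R}) f :
  (mu [set: T] < +oo)%E -> bmeas f ->
  \int[mscale r mu]_x f x = r%:num * \int[mu]_x f x.
Proof.
move=> fmu bf; have fr : (mscale r mu [set: T] < +oo)%E.
  by rewrite /mscale/= lte_mul_pinfty.
have [C fC] := bf.2.
have bC : bmeas (cst C) by exact: bmeas_cst.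
(* Scaling of the measure is applied to the nonnegative function [f + C]; the constant is then
   subtracted on both sides. *)
have E (nu : {measure set T -> \bar R}) : (nu [set: T] < +oo)%E ->
  \int[nu]_x f x = \int[nu]_x (f x + C) - \int[nu]_x C.
  by move=> fnu; rewrite bmeas_RintegralD// addrK.
rewrite (E _ fmu) (E _ fr) mulrBr; congr (_ - _).
  rewrite /Rintegral ge0_integral_mscale//.
  - rewrite fineM//; apply: integrable_fin_num => //.
    exact: (bmeas_integrable fmu measurableT (bmeasD bf bC)).
  - by apply/measurable_EFinP; case: (bmeasD bf bC).
  - by move=> x _; rewrite lee_fin; have := fC x; rewrite ler_norml; lra.
by rewrite !Rintegral_cst// fineM// ?ge0_fin_numE//= mulrCA.
Qed.

End bounded_measurable.

Lemma bmeas_comp {R : realType} {d d'} {T : measurableType d}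
    {T' : measurableType d'} (f : T -> R) (phi : T' -> T) :
  measurable_fun [set: T'] phi -> bmeas f -> bmeas (f \o phi).
Proof.
move=> mphi [mf [C fC]]; split; first exact: measurableT_comp mf mphi.
by exists C => x; exact: fC.
Qed.

Section kernel_integral.
Context {R : realType} {d d'} {T : measurableType d} {T' : measurableType d'}.
Variable m : R.-pker T ~> T'.

Lemma pker_lty x : (m x [set: T'] < +oo)%E.
Proof. by rewrite prob_kernel ltry. Qed.

Lemma pker_Rintegral_cst x (r : R) : \int[m x]_y r = r.
Proof. by rewrite Rintegral_cst// prob_kernel/= mulr1. Qed.

(** Measurability in [x] is obtained for the nonnegative integrand [v + C]; the kernel having mass
    1, the shift changes the integral by exactly [C], and a bound of [v] is also one of its
    averages. *)
Lemma bmeas_pker (v : T' -> R) : bmeas v -> bmeas (fun x => \int[m x]_y v y).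
Proof.
move=> bv; have [mv [C vC]] := bv.
have bC : bmeas (cst C : T' -> R) by exact: bmeas_cst.
split.
  have -> : (fun x => \int[m x]_y v y) = (fun x => \int[m x]_y (v y + C) - C).
    apply/funext => x; rewrite bmeas_RintegralD//; last exact: pker_lty.
    by rewrite pker_Rintegral_cst addrK.
  apply: measurable_funB => //.
  apply: (measurableT_comp (fine_measurable measurableT)).
  apply: (@measurable_fun_integral_kernel _ _ _ _ _ m _ (fun y => (v y + C)%:E)).
  - by move=> U mU; exact: measurable_kernel.
  - by move=> y; rewrite lee_fin; have := vC y; rewrite ler_norml; lra.
  - by apply/measurable_EFinP; case: (bmeasD bv bC).
exists C => x; have fm := pker_lty x.
rewrite ler_norml; apply/andP; split.
  rewrite -[X in X <= _](pker_Rintegral_cst x).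
  apply: bmeas_le_Rintegral => //; first exact: bmeas_cst.
  by move=> y _; have := vC y; rewrite ler_norml => /andP[].
rewrite -[X in _ <= X](pker_Rintegral_cst x).
apply: bmeas_le_Rintegral => //.
by move=> y _; have := vC y; rewrite ler_norml => /andP[].
Qed.

End kernel_integral.

(** * Hahn-Banach *)

Section hb.
Context {R : realType} {E : lmodType R}.
Implicit Types (x y : E) (r s : R) (G : set (E * R)) (Q : E -> R -> Prop).

(** A partial linear functional as a relation. Single-valuedness is not demanded: domination by a
    cone with [Q 0 0] forces it. *)
Definition linear_graph G :=
  [/\ G (0, 0), forall p q, G p -> G q -> G (p.1 + q.1, p.2 + q.2) &
      forall a p, G p -> G (a *: p.1, a * p.2)].

Definition graph_le G Q := forall x r s, G (x, r) -> Q x s -> r <= s.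

Definition major_cone Q :=
  [/\ Q 0 0, forall x y r s, Q x r -> Q y s -> Q (x + y) (r + s) &
      forall a x s, 0 < a -> Q x s -> Q (a *: x) (a * s)].

(** By homogeneity it is enough to treat the coefficients 1 and -1 of [x0]. They ask for [r0] below
    all [s - r] with [Q (x + x0) s] and above all [r - s] with [Q (x - x0) s]; adding the two
    vectors shows that the second numbers lie below the first, so the supremum of the second works.
    The two majorants at [x0] and [- x0] make that supremum exist. *)
Lemma graph_extend Q G x0 : major_cone Q -> linear_graph G -> graph_le G Q ->
  (exists s, Q x0 s) -> (exists s, Q (- x0) s) ->
  exists r0, graph_le [set p | exists q a, G q /\
    p = (q.1 + a *: x0, q.2 + a * r0)] Q.
Proof.
move=> [Q0 QD QZ] [G0 GD GZ] GQ [s1 Qs1] [s2 Qs2].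
pose S := [set z | exists x r s, [/\ G (x, r), Q (x - x0) s & z = r - s]].
have Sub x r s : G (x, r) -> Q (x + x0) s -> ubound S (s - r).
  move=> Gx Qx _ [x' [r' [s' [Gx' Qx' ->]]]].
  have := GQ _ _ _ (GD _ _ Gx Gx'); move/(_ (s + s')) => /=.
  have -> : x + x' = (x + x0) + (x' - x0) by rewrite addrACA subrr addr0.
  by move=> /(_ (QD _ _ _ _ Qx Qx')); lra.
have SS : has_sup S.
  split; first by exists (0 - s2), 0, 0, s2; split => //; rewrite add0r.
  by exists (s1 - 0); apply: (Sub 0) => //; rewrite add0r.
exists (sup S) => x r s [[x' r'] [a [Gx' /= [-> ->]]]] Qs.
have [a0|a0|a0] := ltgtP a 0; last by move: Qs; rewrite a0 scale0r mul0r !addr0; apply: GQ.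
- have ai : 0 < (- a)^-1 by rewrite invr_gt0 oppr_gt0.
  have a0' : a != 0 by rewrite lt_eqF.
  have : S ((- a)^-1 * r' - (- a)^-1 * s).
    exists ((- a)^-1 *: x'), ((- a)^-1 * r'), ((- a)^-1 * s); split => //.
      exact: (GZ _ _ Gx').
    have := QZ _ _ _ ai Qs; rewrite scalerDr scalerA; congr (Q (_ + _) _).
    by rewrite invrN mulNr mulVf// scaleN1r.
  move=> /(ub_le_sup SS.2).
  rewrite -mulrBr ler_pdivrMl ?oppr_gt0//; lra.
- have ai : 0 < a^-1 by rewrite invr_gt0.
  have a0' : a != 0 by rewrite gt_eqF.
  have : sup S <= a^-1 * s - a^-1 * r'.
    apply: ge_sup; first by case: SS.
    apply: (Sub (a^-1 *: x')); first exact: (GZ _ _ Gx').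
    have := QZ _ _ _ ai Qs; rewrite scalerDr scalerA; congr (Q (_ + _) _).
    by rewrite mulVf// scale1r.
  rewrite -mulrBr ler_pdivlMl//; lra.
Qed.

(* Domination by a cone [Q] of pairs (vector, upper bound) instead of by a
   sublinear functional allows [Q] to be void at some vectors. *)
Theorem hahn_banach_cone Q G0 : major_cone Q -> linear_graph G0 ->
  graph_le G0 Q ->
  exists f : E -> R, let B := [set x | exists s t, Q x s /\ Q (- x) t] in
    [/\ forall x y, B x -> B y -> f (x + y) = f x + f y,
        forall a x, B x -> f (a *: x) = a * f x,
        forall x s, B x -> Q x s -> f x <= s &
        forall x r, B x -> G0 (x, r) -> f x = r].
Proof.
move=> cQ lG0 G0Q; have [Q0 QD QZ] := cQ.
(* [G0] is adjoined inside [P] so that the empty chain, whose union is empty, satisfies [P] as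
   well. *)
pose P G := linear_graph (G0 `|` G) /\ graph_le (G0 `|` G) Q.
have [|G [[lG GQ] Gmax]] := @Zorn_bigcup _ P.
  move=> F FP Ftot; split; first split.
  - by left; case: lG0.
  - move=> p q [pG|[X FX pX]] [qG|[Y FY qY]].
    + by left; case: lG0 => _ + _; exact.
    + have [[_ + _] _] := FP _ FY; move=> /(_ p q) [||?|?]; [by left|by right|by left|].
      by right; exists Y.
    + have [[_ + _] _] := FP _ FX; move=> /(_ p q) [||?|?]; [by right|by left|by left|].
      by right; exists X.
    + have [XY|YX] := Ftot _ _ FX FY.
        have [[_ + _] _] := FP _ FY; move=> /(_ p q) [||?|?]; [by right; exact: XY|by right|by left|].
        by right; exists Y.
      have [[_ + _] _] := FP _ FX; move=> /(_ p q) [||?|?]; [by right|by right; exact: YX|by left|].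
      by right; exists X.
  - move=> a p [pG|[X FX pX]]; first by left; case: lG0 => _ _; exact.
    have [[_ _ +] _] := FP _ FX; move=> /(_ a p) [|?|?]; [by right|by left|].
    by right; exists X.
  - move=> x r s [xG|[X FX xX]]; first exact: G0Q.
    by have [_] := FP _ FX; apply; right.
set H := G0 `|` G in lG GQ.
have [H0 HD HZ] := lG.
have Hfun x r r' : H (x, r) -> H (x, r') -> r = r'.
  move=> Hr Hr'; have D := HD _ _ Hr (HZ (-1) _ Hr').
  have D' := HD _ _ Hr' (HZ (-1) _ Hr).
  move: D D'; rewrite /= scaleN1r subrr => /GQ/(_ Q0) + /GQ/(_ Q0); lra.
have Htot x : (exists s, Q x s) -> (exists s, Q (- x) s) -> exists r, H (x, r).
  move=> Qx Qx'; apply: contrapT => nH.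
  have [r0 H'Q] := graph_extend cQ lG GQ Qx Qx'.
  set H' := [set p | _] in H'Q.
  have HH' : H `<=` H'.
    by move=> [y r] Hy; exists (y, r), 0; rewrite /= scale0r mul0r !addr0.
  apply: (Gmax H').
    split; first by move=> p Gp; apply: HH'; right.
    move=> H'G; apply: nH; exists r0; right; apply: H'G.
    by exists (0, 0), 1; rewrite /= scale1r mul1r !add0r.
  have E' : G0 `|` H' = H' by apply/setUidPr => p Gp; apply: HH'; left.
  rewrite /P E'; split => //; split; first exact: HH'.
  - move=> _ _ [q [a [Hq ->]]] [q' [a' [Hq' ->]]]; exists (q.1 + q'.1, q.2 + q'.2), (a + a').
    by split; [exact: HD|rewrite /= scalerDl mulrDl; congr (_, _); rewrite addrACA].
  - move=> b _ [q [a [Hq ->]]]; exists (b *: q.1, b * q.2), (b * a).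
    by split; [exact: HZ|rewrite /= scalerDr mulrDr scalerA mulrA].
(* The default 0 is taken only outside the domain of [H]; by maximality that domain contains [B]. *)
pose f x := xget 0 [set r | H (x, r)].
exists f => B.
have Hf x : B x -> H (x, f x).
  move=> [s [t [xs xt]]]; have [|| r Hr] := Htot x; [by exists s|by exists t|].
  exact: (@xgetPex _ 0 [set r | H (x, r)] (ex_intro _ r Hr)).
have BH x r : B x -> H (x, r) -> f x = r.
  by move=> Bx Hr; exact: (Hfun _ _ _ (Hf _ Bx) Hr).
split.
- move=> x y Bx By; apply: BH; last exact: (HD _ _ (Hf _ Bx) (Hf _ By)).
  case: Bx By => [s [t [xs xt]]] [s' [t' [ys yt]]].
  by exists (s + s'), (t + t'); rewrite opprD; split; apply: QD.
- move=> a x Bx; apply: BH; last exact: (HZ _ _ (Hf _ Bx)).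
  case: Bx => [s [t [xs xt]]]; have [a0|a0|->] := ltgtP a 0.
  + exists (- a * t), (- a * s); rewrite -scaleNr -(opprK (a *: x)) -scalerN -scaleNr.
    by split; apply: QZ => //; rewrite oppr_gt0.
  + by exists (a * s), (a * t); rewrite -scalerN; split; apply: QZ.
  + by exists 0, 0; rewrite scale0r oppr0.
- by move=> x s Bx Qs; exact: GQ (Hf _ Bx) Qs.
- by move=> x r Bx Gx; apply: BH => //; left.
Qed.

End hb.

(** * Binary codes *)

Section bits.

(* Most recent bit first. *)
Fixpoint rbits (z : nat -> bool) (n : nat) : seq bool :=
  if n is m.+1 then z m :: rbits z m else [::].

Lemma size_rbits z n : size (rbits z n) = n.
Proof. by elim: n => //= n ->. Qed.

Lemma eq_rbits z z' n :
  (forall k, (k < n)%N -> z k = z' k) <-> rbits z n = rbits z' n.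
Proof.
elim: n => [|n IH]; first by split => // _ k.
split => [zz'|/= [zn /IH zz'] k].
  by rewrite /= zz'// (IH.1 _)// => k kn; apply: zz'; rewrite ltnS ltnW.
by rewrite ltnS leq_eqVlt => /orP[/eqP ->//|]; exact: zz'.
Qed.

(** Padding by [false] selects a reference point in the cylinder of [s]; [rev] compensates for the
    storage order. *)
Definition ext (s : seq bool) : nat -> bool := nth false (rev s).

Lemma rbits_ext s : rbits (ext s) (size s) = s.
Proof.
elim: s => //= b s IH; congr (_ :: _).
  by rewrite /ext rev_cons nth_rcons size_rev ltnn eqxx.
rewrite -[RHS]IH; apply/eq_rbits => k ks.
by rewrite /ext rev_cons nth_rcons size_rev ks.
Qed.

(** Uniform continuity in terms of common prefixes, by compactness of the square. Near a diagonal
    point both images are within [e / 2] of its image; near any other point some bit [k] separates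
    the two sequences, so the premise fails as soon as [n] exceeds [k]. *)
Lemma cantor_modulus {R : realType} {V : pseudoMetricType R}
    (f : cantor_space -> V) (e : R) : continuous f -> 0 < e ->
  exists n, forall z z', rbits z n = rbits z' n -> ball (f z) e (f z').
Proof.
move=> cf e0.
have cK : compact ([set: cantor_space] `*` [set: cantor_space]).
  by apply: compact_setX; exact: cantor_space_compact.
pose P n (zz : cantor_space * cantor_space) :=
  rbits zz.1 n = rbits zz.2 n -> ball (f zz.1) e (f zz.2).
suff : \forall n \near \oo, [set: cantor_space] `*` [set: cantor_space] `<=` P n.
  by case=> n _ /(_ n (leqnn n)) H; exists n => z z'; exact: (H (z, z')).
move/compact_near_coveringP : cK; apply => -[z z'] _ /=.
have [->{z}|/eqP zz'] := eqVneq z z'.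
  exists (((f @^-1` ball (f z') (e / 2)) `*` (f @^-1` ball (f z') (e / 2))), setT) => /=.
    split; last exact: filterT.
    exists (f @^-1` ball (f z') (e / 2), f @^-1` ball (f z') (e / 2)) => //=.
    by split; apply: cf; apply: nbhsx_ballx; rewrite divr_gt0.
  move=> [[w w'] n] /= [[wz w'z] _] _.
  by rewrite (splitr e); apply: ball_triangle w'z; exact: ball_sym.
have [k zk] : exists k, z k <> z' k.
  by apply: contrapT => /forallNP H; apply: zz'; apply: funext => k; exact: contrapT (H k).
have cyl (w : cantor_space) : nbhs w [set w' : cantor_space | w' k = w k].
  have := @proj_continuous _ (fun _ : nat => bool) k w [set w k].
  by apply; rewrite nbhs_principalE; exact/principal_filterP.
exists ([set w | w k = z k] `*` [set w | w k = z' k], [set n | (k < n)%N]) => /=.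
  split; last exact: nbhs_infty_gt.
  by exists ([set w | w k = z k], [set w | w k = z' k]) => //=; split; exact: cyl.
move=> [[w w'] n] /= [[wz w'z] kn] /eq_rbits/(_ k kn)/=.
by rewrite wz w'z.
Qed.

End bits.

(** * Measures as trees of masses *)

Lemma measurable_fun_borel {R : realType} {d} {T : measurableType d}
    {X : pmetricType R} (f : T -> borel X) :
  (forall U : set X, open U -> measurable (f @^-1` U)) ->
  measurable_fun [set: T] f.
Proof.
move=> fU.
have H : preimage_set_system [set: T] f (@open X) `<=` measurable.
  by move=> _ [U oU <-]; rewrite setTI; exact: fU.
have E : @measurable _ (borel X) = <<s (@open X : set (set (borel X))) >> by [].
exact: (@measurability _ _ T (borel X) setT f _ E H).
Qed.

Section tree.
Context {R : realType}.
Implicit Types (p : seq bool -> R) (s : seq bool) (t : R).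

(* [p s] is the mass of the node [s]; nodes of equal depth are laid out on the
   line from left to right, and [lo p s] is the left end of the interval, of
   length [p s], assigned to [s]. *)
Fixpoint lo p s : R :=
  if s is b :: s' then lo p s' + (if b then p (false :: s') else 0) else 0.

Fixpoint branch p t n : seq bool :=
  if n is m.+1 then
    (lo p (true :: branch p t m) <= t) :: branch p t m
  else [::].

Definition tree_mass p :=
  [/\ p [::] = 1, forall s, 0 <= p s &
      forall s, p s = p (false :: s) + p (true :: s)].

Definition limit_branch p t : cantor_space :=
  fun n => lo p (true :: branch p t n) <= t.

Lemma rbits_limit_branch p t n : rbits (limit_branch p t) n = branch p t n.
Proof. by elim: n => //= n ->. Qed.

Lemma size_branch p t n : size (branch p t n) = n.
Proof. by rewrite -rbits_limit_branch size_rbits. Qed.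

Lemma branch_in p t n : tree_mass p -> 0 <= t < 1 ->
  lo p (branch p t n) <= t < lo p (branch p t n) + p (branch p t n).
Proof.
move=> [p1 p0 pD] t01; elim: n => [|n IH]; first by rewrite /= p1 add0r.
move: IH => /andP[H1 H2]; rewrite (pD (branch p t n)) in H2.
by rewrite /=; case: (leP (_ + p (false :: _)) t) => H3 /=; apply/andP; split; lra.
Qed.

(** The interval of a child lies in that of its parent, so the parent is found by induction, and the
    side of the cut between the siblings gives the last bit. *)
Lemma branch_uniq p t s : tree_mass p -> lo p s <= t < lo p s + p s ->
  branch p t (size s) = s.
Proof.
move=> [p1 p0 pD]; elim: s => //= b s IH st.
have q0 := p0 (true :: s); have q1 := p0 (false :: s); have q2 := pD s.
have -> : branch p t (size s) = s.
  by apply: IH; move: st => /andP[]; case: b => /= *; apply/andP; split; lra.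
by congr (_ :: _); move: st => /andP[]; case: b => /= *; apply/idP; lra.
Qed.

Lemma lo_bounds p s : tree_mass p -> 0 <= lo p s /\ lo p s + p s <= 1.
Proof.
move=> [p1 p0 pD]; elim: s => [|b s IH]/=; first by rewrite p1 add0r.
have q0 := p0 (true :: s); have q1 := p0 (false :: s); have q2 := pD s.
by case: b => /=; lra.
Qed.

Lemma branchE p t s : tree_mass p -> 0 <= t < 1 ->
  (branch p t (size s) == s) = (lo p s <= t < lo p s + p s).
Proof.
move=> tp t01; apply/eqP/idP => [E|]; last exact: branch_uniq.
by have := branch_in (size s) tp t01; rewrite E.
Qed.

End tree.

Section tree_measurable.
Context {R : realType} {d} {T : measurableType d}.
Variable p : seq bool -> T -> R.
Hypothesis mp : forall s, measurable_fun [set: T] (p s).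

Let P w s := p s w.

Lemma measurable_lo s : measurable_fun [set: T] (fun w => lo (P w) s).
Proof.
elim: s => [|b s IH]/=; first exact: measurable_cst.
by apply: measurable_funD => //; case: b; [exact: mp|exact: measurable_cst].
Qed.

Lemma measurable_branch s :
  measurable [set z : T * measurableTypeR R | branch (P z.1) z.2 (size s) = s].
Proof.
elim: s => [|b s IH].
  by rewrite (_ : mkset _ = setT)//; apply/seteqP; split.
have ml : measurable [set z : T * measurableTypeR R | (lo (P z.1) (true :: s) <= z.2) = b].
  have m1 : measurable_fun [set: T * measurableTypeR R] (fun z => lo (P z.1) (true :: s)).
    exact: measurableT_comp (measurable_lo (true :: s)) measurable_fst.
  have m2 : measurable_fun [set: T * measurableTypeR R] (snd : _ -> R).
    exact: (@measurable_snd _ _ T (measurableTypeR R)).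
  have := measurable_fun_ler m1 m2.
  by move=> /(_ measurableT [set b] Logic.I); rewrite setTI.
rewrite (_ : mkset _ = [set z : T * measurableTypeR R | branch (P z.1) z.2 (size s) = s] `&`
    [set z : T * measurableTypeR R | (lo (P z.1) (true :: s) <= z.2) = b]); first exact: measurableI.
apply/seteqP; split => [z /= [zb zs]|z /= [zs zb]]; last by rewrite zs zb.
by split => //; move: zb; rewrite zs.
Qed.

Variables (X : pmetricType R) (g : cantor_space -> X).
Hypothesis cg : continuous g.

(** By uniform continuity, a limit branch is sent into the open set [U] if and only if some prefix
    of it has its whole cylinder sent into [U]. There are countably many words, and each is a prefix
    on a measurable set. *)
Lemma measurable_limit_branch : measurable_fun [set: T * measurableTypeR R]
  (fun z => (g (limit_branch (P z.1) z.2) : borel X)).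
Proof.
apply: measurable_fun_borel => U oU.
pose S := [set s | forall z, rbits z (size s) = s -> U (g z)].
rewrite (_ : _ @^-1` _ =
    \bigcup_(s in S) [set z : T * measurableTypeR R | branch (P z.1) z.2 (size s) = s]).
  rewrite bigcup_mkcond; apply: countable_bigcupT_measurable => // s.
  by case: ifP => // _; exact: measurable_branch.
apply/seteqP; split => [z /= Uz|z [s Ss /= zs]]; last first.
  by apply: Ss; rewrite rbits_limit_branch.
have /nbhs_ballP[e /= e0 eU] : nbhs (g (limit_branch (P z.1) z.2)) U.
  by apply: open_nbhs_nbhs; split.
have [n gn] := cantor_modulus cg e0.
exists (branch (P z.1) z.2 n); last by rewrite /= size_branch.
move=> z' /=; rewrite size_branch => z'n.
by apply: eU; apply: gn; rewrite rbits_limit_branch.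
Qed.

End tree_measurable.

Lemma measurable_fun_gt {R : realType} {d} {T : measurableType d} (f : T -> R) :
  (forall a, measurable [set x | a < f x]) -> measurable_fun [set: T] f.
Proof.
move=> mf; apply: (measurability _ (RGenOInfty.measurableE R)).
move=> _ [_ [a ->] <-]; rewrite setTI.
rewrite (_ : _ @^-1` _ = [set x | a < f x])//.
by apply/seteqP; split => x /=; rewrite in_itv/= andbT.
Qed.

Lemma borel_open_measurable {R : realType} {X : pmetricType R} (U : set X) :
  open U -> measurable (U : set (borel X)).
Proof. exact: sub_sigma_algebra. Qed.

Lemma borel_closed_measurable {R : realType} {X : pmetricType R} (F : set X) :
  closed F -> measurable (F : set (borel X)).
Proof.
by rewrite -openC => /borel_open_measurable/measurableC; rewrite setCK.
Qed.

Lemma bmeas_continuous {R : realType} {X : pmetricType R} (v : X -> R) :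
  compact [set: X] -> continuous v -> bmeas (v : borel X -> R).
Proof.
move=> cX cv; split.
  apply: measurable_fun_gt => a; apply: borel_open_measurable.
  rewrite (_ : mkset _ = v @^-1` `]a, +oo[%classic).
    by apply: open_comp => // x _; exact: cv.
  by apply/seteqP; split => x /=; rewrite in_itv/= andbT.
have /compact_bounded[M [_ HM]] : compact (v @` [set: X]).
  by apply: continuous_compact => //; exact: continuous_subspaceT.
by exists (M + 1) => x; apply: (HM (M + 1)); [rewrite ltrDl|exists x].
Qed.

Lemma uniform_prob01_itv {R : realType} (x y : R) : 0 <= x -> x <= y -> y <= 1 ->
  uniform_prob (@ltr01 R) `[x, y[%classic = (y - x)%:E.
Proof.
move=> x0 xy y1.
have mI : measurable (`[x, y[%classic : set R) by exact: measurable_itv.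
transitivity (\int[uniform_prob (@ltr01 R)]_t (\1_(`[x, y[%classic) t)%:E)%E.
  by rewrite integral_indic// setIT.
rewrite integral_uniform//.
- rewrite subr0 invr1 mul1e integral_indic// setIidl.
    apply: (etrans (lebesgue_measure_itv _)); rewrite /= lte_fin.
    by case: ltgtP xy => // ->; rewrite subrr.
  by move=> t /=; rewrite !in_itv/=; lra.
- by apply/measurable_EFinP; exact: measurable_indic.
Qed.

Section tree_kernel.
Context {R : realType} {d} {Om : measurableType d} {X : pmetricType R}.
Variables (p : seq bool -> Om -> R) (g : cantor_space -> X) (c : Om -> borel X)
  (N : set Om).
Hypothesis mp : forall s, measurable_fun [set: Om] (p s).
Hypothesis cg : continuous g.
Hypothesis mc : measurable_fun [set: Om] c.
Hypothesis mN : measurable N.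

(** The value [c w] on the exceptional set and for [t] outside [0,1) lies in every ball about the
    centre, so that the resulting kernel is carried by the ball at every [w] and not just at almost
    every one. *)
Definition tree_map (z : Om * measurableTypeR R) : borel X :=
  if (z.1 \notin N) && (0 <= z.2 < 1)
  then g (limit_branch (p ^~ z.1) z.2) else c z.1.

Lemma measurable_tree_map : measurable_fun [set: Om * measurableTypeR R] tree_map.
Proof.
apply: measurable_fun_ifT.
- apply: (measurable_fun_bool true); rewrite setTI.
  rewrite (_ : _ @^-1` _ = ~` N `*` `[0, 1[%classic).
    by apply: measurableX; [exact: measurableC|exact: measurable_itv].
  apply/seteqP; split => [[w t]/= /andP[/negP wN t01]|[w t]/= [wN]].
    by split; [move=> /mem_set|rewrite in_itv].
  by rewrite in_itv/= => ->; rewrite andbT; apply/negP => /set_mem.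
- exact: (measurable_limit_branch mp cg).
- exact: measurableT_comp mc measurable_fst.
Qed.

Let Tw w : measurableTypeR R -> borel X := fun t => tree_map (w, t).

Let mTw w : measurable_fun [set: measurableTypeR R] (Tw w).
Proof. exact: measurableT_comp measurable_tree_map (measurable_pair1 w). Qed.

Definition tree_mfun w : {mfun measurableTypeR R >-> borel X} := mfun_Sub (mem_set (mTw w)).

Definition tree_ker (w : Om) : {measure set (borel X) -> \bar R} :=
  distribution (uniform_prob (@ltr01 R)) (tree_mfun w).

Let mker U : measurable U -> measurable_fun [set: Om] (tree_ker ^~ U).
Proof.
move=> mU.
have m1 : measurable (tree_map @^-1` U).
  by rewrite -[X in measurable X]setTI; exact: measurable_tree_map.
have := measurable_fun_xsection (uniform_prob (@ltr01 R)) m1.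
apply: eq_measurable_fun => w _ /=.
rewrite /tree_ker /= /distribution /pushforward/= /xsection/=.
by congr (uniform_prob _ _); apply/seteqP; split => t /=; rewrite inE.
Qed.

HB.instance Definition _ := isKernel.Build _ _ _ _ R tree_ker mker.

Let ker1 w : tree_ker w [set: borel X] = 1%E.
Proof. by rewrite /tree_ker /distribution /pushforward/= preimage_setT probability_setT. Qed.

HB.instance Definition _ := Kernel_isProbability.Build _ _ _ _ R tree_ker ker1.

Definition tree_pker : R.-pker Om ~> borel X := tree_ker.

End tree_kernel.

Section tree_kernel_properties.
Context {R : realType} {d} {Om : measurableType d} {X : pmetricType R}.
Variables (p : seq bool -> Om -> R) (g : cantor_space -> X) (c : Om -> borel X)
  (N : set Om).
Hypothesis mp : forall s, measurable_fun [set: Om] (p s).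
Hypothesis cg : continuous g.
Hypothesis mc : measurable_fun [set: Om] c.
Hypothesis mN : measurable N.
Hypothesis tmp : forall w, ~ N w -> tree_mass (p ^~ w).

Let K := tree_pker mp cg mc mN.
Let U : probability (measurableTypeR R) R := uniform_prob (@ltr01 R).

Lemma tree_pker_cball (eps : R) (delta : seq bool -> R) : 0 <= eps ->
  (forall s z, rbits z (size s) = s -> mdist (g (ext s)) (g z) <= delta s) ->
  (forall e, 0 < e -> exists n, forall s, size s = n -> delta s <= e) ->
  (forall w s, ~ N w -> eps + delta s < mdist (c w : X) (g (ext s)) -> p s w = 0) ->
  forall w, K w (~` cball (c w : X) eps) = 0%E.
Proof.
move=> eps0 dg dn pN w.
rewrite /K /tree_pker /= /tree_ker /distribution /pushforward /=.
rewrite (_ : _ @^-1` _ = set0) ?measure0//.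
apply/seteqP; split => // t /=; apply; rewrite /tree_map /cball /=.
case: ifPn => [/andP[/negP wN /= t01]|_]; last by rewrite mdistxx.
have {}wN : ~ N w by move=> /mem_set.
apply/ler_addgt0Pl => e e0; have e20 : 0 < e / 2 by rewrite divr_gt0.
have [n dne] := dn _ e20.
set s := branch (p ^~ w) t n.
have ss : size s = n by exact: size_branch.
have ps : p s w != 0.
  by have := branch_in n (tmp wN) t01; rewrite -/s; apply: contraTneq => ->; lra.
have ds : mdist (c w : X) (g (ext s)) <= eps + delta s.
  by rewrite leNgt; apply: contraNN ps => /(pN _ _ wN) ->.
have dz : mdist (g (ext s)) (g (limit_branch (p ^~ w) t)) <= delta s.
  by apply: dg; rewrite ss rbits_limit_branch.
have := metric_triangle (c w : X) (g (ext s)) (g (limit_branch (p ^~ w) t)).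
by have := dne _ ss; lra.
Qed.

Lemma uniform_prob_ae : {ae U, forall t, 0 <= t < 1}.
Proof.
exists (~` `[0, 1[%classic); split.
- by apply: measurableC; exact: measurable_itv.
- have mI : measurable (`[0, 1[%classic : set (measurableTypeR R)).
    exact: measurable_itv.
  apply: (etrans (probability_setC U mI)).
  have E := @uniform_prob01_itv R 0 1 (lexx _) ler01 (lexx _).
  by apply: (etrans (congr1 (fun z => 1 - z)%E E)); rewrite subr0 -EFinB subrr.
- by move=> t /= t01; rewrite in_itv.
Qed.

(** Replacing [v] by its value at the reference point of the cylinder of depth [n] costs at most
    [e]. The integral of the step function so obtained is exactly the sum, the interval of [s]
    having length [p s w]. *)
Lemma tree_pker_Rintegral (v : X -> R) (e : R) n w :
  compact [set: X] -> continuous v -> ~ N w ->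
  (forall z z', rbits z n = rbits z' n -> `|v (g z) - v (g z')| <= e) ->
  `| \int[K w]_y v y - \sum_(s : n.-tuple bool) v (g (ext s)) * p s w | <= e.
Proof.
move=> cX cv wN vn.
have bv : bmeas (v : borel X -> R) by exact: bmeas_continuous.
have fU : (U [set: _] < +oo)%E by rewrite probability_setT ltry.
pose T : measurableTypeR R -> borel X := fun t => tree_map p g c N (w, t).
have mT : measurable_fun [set: measurableTypeR R] T.
  by exact: measurableT_comp (measurable_tree_map mp cg mc mN) (measurable_pair1 w).
have bT : bmeas (fun t : measurableTypeR R => v (T t)) by exact: bmeas_comp mT bv.
have -> : \int[K w]_y v y = \int[U]_t v (T t).
  congr fine; apply: integral_distribution.
    by apply/measurable_EFinP; case: bv.
  exact: (bmeas_integrable fU measurableT bT).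
pose I (s : n.-tuple bool) : set (measurableTypeR R) :=
  `[lo (p ^~ w) s, lo (p ^~ w) s + p s w[%classic.
have mI s : measurable (I s) by exact: measurable_itv.
pose h (t : measurableTypeR R) := \sum_(s : n.-tuple bool) v (g (ext s)) * \1_(I s) t.
have bh : bmeas h.
  by apply: bmeas_sum => s; apply: bmeasZ; exact: bmeas_indic.
have tm := tmp wN.
have -> : \sum_(s : n.-tuple bool) v (g (ext s)) * p s w = \int[U]_t h t.
  rewrite bmeas_Rintegral_sum//; last by move=> s; apply: bmeasZ; exact: bmeas_indic.
  apply: eq_bigr => s _; rewrite bmeas_RintegralZ//; last exact: bmeas_indic.
  congr (_ * _); rewrite Rintegral_indic// setIT.
  have [l0 l1] := lo_bounds s tm; have [_ p0 _] := tm.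
  have := uniform_prob01_itv l0 _ l1; rewrite lerDl addrAC subrr add0r.
  by move=> /(_ (p0 s)) E; apply/esym; apply: (etrans (congr1 fine E)).
have hT : {ae U, forall t, `|v (T t) - h t| <= e}.
  apply: filterS uniform_prob_ae; first exact: (ae_filter_ringOfSetsType U).
  move=> t t01.
  have sB : size (branch (p ^~ w) t n) == n by rewrite size_branch.
  have -> : h t = v (g (ext (branch (p ^~ w) t n))).
    rewrite /h (bigD1 (Tuple sB))//= big1 ?addr0; last first.
      move=> s sn; rewrite indicE (_ : (t \in I s) = false) ?mulr0//.
      apply/negbTE; apply: contraNN sn => /set_mem; rewrite /I /= in_itv/= => ts.
      by rewrite -val_eqE/= eq_sym; move: ts; rewrite -(branchE s tm t01) size_tuple.
    have It : I (Tuple sB) t by rewrite /I /= in_itv/=; exact: (branch_in n tm t01).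
    by rewrite indicE (mem_set It) mulr1.
  rewrite /T /tree_map /= t01 andbT.
  have -> /= : w \notin N by apply/negP => /set_mem.
  apply: vn; rewrite rbits_limit_branch.
  by have := rbits_ext (branch (p ^~ w) t n); rewrite size_branch => ->.
have c1 : \int[U]_t e = e.
  rewrite Rintegral_cst// (_ : fine _ = 1) ?mulr1//.
  exact: (congr1 fine (probability_setT U)).
have be : bmeas (cst e : measurableTypeR R -> R) by exact: bmeas_cst.
have l1 : \int[U]_t v (T t) <= \int[U]_t h t + e.
  rewrite -[X in _ <= _ + X]c1 -bmeas_RintegralD//.
  apply: bmeas_le_Rintegral_ae => //; first exact: bmeasD.
  apply: (@filterS _ _ (ae_filter_ringOfSetsType U) _ _ _ hT).
  by move=> t + _; rewrite ler_norml; lra.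
have l2 : \int[U]_t h t <= \int[U]_t v (T t) + e.
  rewrite -[X in _ <= _ + X]c1 -bmeas_RintegralD//.
  apply: bmeas_le_Rintegral_ae => //; first exact: bmeasD.
  apply: (@filterS _ _ (ae_filter_ringOfSetsType U) _ _ _ hT).
  by move=> t + _; rewrite ler_norml; lra.
by rewrite ler_norml; apply/andP; split; lra.
Qed.

End tree_kernel_properties.

(** * Disintegration of positive functionals *)

Section dominated_density.
Context {R : realType} {d} {T : measurableType d}.
Variables (P : {finite_measure set T -> \bar R}) (lam : set T -> R).
Hypothesis lam_ge0 : forall A, 0 <= lam A.
Hypothesis lam_le : forall A, measurable A -> lam A <= fine (P A).
Hypothesis lamU : forall A B, measurable A -> measurable B ->
  A `&` B = set0 -> lam (A `|` B) = lam A + lam B.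

Let lamE (A : set T) : \bar R := (lam A)%:E.

Let lamE0 : lamE set0 = 0%E.
Proof.
congr EFin; apply/eqP; rewrite eq_le lam_ge0 andbT.
by have := lam_le measurable0; rewrite measure0.
Qed.

Let lamE_ge0 A : (0 <= lamE A)%E. Proof. by rewrite lee_fin. Qed.

Let lam_sum F : (forall i, measurable (F i)) -> trivIset [set: nat] F ->
  forall n, lam (\big[setU/set0]_(i < n) F i) = \sum_(0 <= i < n) lam (F i).
Proof.
move=> mF tF; elim=> [|n IH].
  by rewrite big_ord0 big_geq//; case: lamE0.
rewrite big_ord_recr/= big_nat_recr//= lamU ?IH//.
  exact: bigsetU_measurable.
rewrite -bigcup_mkord; apply/seteqP; split => // t [[i /= ni Fi] Fn].
have E : i = n by apply: tF => //; exists t.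
by move: ni; rewrite E ltnn.
Qed.

(** Finite additivity suffices under domination by a finite measure: the remainder of a countable
    union has [lam]-mass at most its [P]-mass, which tends to 0. *)
Let lamE_sigma_additive : semi_sigma_additive lamE.
Proof.
move=> F mF tF mUF; set UF := \bigcup_n F n.
have finP A : measurable A -> P A \is a fin_num by move=> mA; exact: fin_num_measure.
have := measure_semi_sigma_additive F mF tF mUF; rewrite -/UF => PF.
have {}PF : \sum_(0 <= i < n) fine (P (F i)) @[n --> \oo] --> fine (P UF).
  have {}PF : \sum_(0 <= i < n) P (F i) @[n --> \oo] --> (fine (P UF))%:E.
    by rewrite fineK ?finP.
  move/fine_cvg : PF.
  rewrite (_ : fine \o _ = (fun n => \sum_(0 <= i < n) fine (P (F i))))//.
  by apply/funext => n; rewrite /= sum_fine// => i _; exact: finP.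
rewrite (_ : (fun n => _) = EFin \o (fun n => \sum_(0 <= i < n) lam (F i))); last first.
  by apply/funext => n; rewrite /= -sumEFin.
apply: cvg_EFin; first by near=> n.
rewrite (_ : fine \o _ = (fun n => \sum_(0 <= i < n) lam (F i)))//=.
pose lo n := lam UF - (fine (P UF) - \sum_(0 <= i < n) fine (P (F i))).
apply: (@squeeze_cvgr _ _ _ _ lo (cst (lam UF))).
- near=> n; set V := \big[setU/set0]_(i < n) F i.
  have mV : measurable V by apply: bigsetU_measurable.
  have VU : V `<=` UF by rewrite /V -bigcup_mkord; apply: bigcup_sub => i _; exact: bigcup_sup.
  have UV : UF = V `|` (UF `\` V) by rewrite setDE setUIr setUv setIT; apply/esym/setUidPr.
  have mD : measurable (UF `\` V) by exact: measurableD.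
  have VD : V `&` (UF `\` V) = set0 by rewrite setDE setICA setICr setI0.
  have PV : fine (P UF) = \sum_(0 <= i < n) fine (P (F i)) + fine (P (UF `\` V)).
    rewrite {1}UV measureU// fineD ?finP//; congr (_ + _).
    by rewrite /V measure_bigsetU// big_mkord -sum_fine// => i _; exact: finP.
  have lV : lam UF = \sum_(0 <= i < n) lam (F i) + lam (UF `\` V).
    by rewrite {1}UV lamU// -lam_sum.
  have := lam_le mD; have := lam_ge0 (UF `\` V); rewrite /lo /= => l0 l1.
  by apply/andP; split; lra.
- rewrite -[X in _ --> X]subr0 -(subrr (fine (P UF))).
  by apply: cvgB; [exact: cvg_cst|apply: cvgB => //; exact: cvg_cst].
- exact: cvg_cst.
Unshelve. all: by end_near. Qed.

HB.instance Definition _ := isMeasure.Build _ _ _ lamE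
  lamE0 lamE_ge0 lamE_sigma_additive.

Let lamE_fin : fin_num_fun lamE. Proof. by []. Qed.

HB.instance Definition _ := @Measure_isFinite.Build _ _ _ lamE lamE_fin.

Lemma dominated_density : exists f : T -> R,
  [/\ forall x, 0 <= f x, P.-integrable [set: T] (EFin \o f) &
      forall A, measurable A -> (lam A)%:E = (\int[P]_(x in A) (f x)%:E)%E].
Proof.
have dom : lamE `<< P.
  apply/null_content_dominatesP => A mA PA0; congr EFin; apply/eqP.
  by rewrite eq_le lam_ge0 andbT; have := lam_le mA; rewrite PA0.
pose f := Radon_Nikodym_SigmaFinite.f lamE P.
have ff x : (fine (f x))%:E = f x.
  by rewrite fineK//; exact: Radon_Nikodym_SigmaFinite.f_fin_num.
exists (fine \o f); split => [x||A mA].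
- by apply: fine_ge0; exact: Radon_Nikodym_SigmaFinite.f_ge0.
- rewrite (_ : _ \o _ = f); last by apply/funext => x /=; rewrite ff.
  exact: Radon_Nikodym_SigmaFinite.f_integrable.
- rewrite [LHS](Radon_Nikodym_SigmaFinite.f_integral dom mA).
  by apply: eq_integral => x _ /=; rewrite ff.
Qed.

End dominated_density.

Section mdist.
Context {R : realType} {X : pmetricType R}.

Lemma mdist_continuous (x : X) : continuous (mdist x : X -> R).
Proof.
move=> y; apply/cvgrPdist_le => e e0.
have := nbhsx_ballx y e e0; apply: filterS => z; rewrite ballEmdist /= => yz.
have := metric_triangle x y z; have := metric_triangle x z y.
by rewrite (metric_sym z y) ler_norml => ? ?; apply/andP; split; lra.
Qed.

Lemma mdist_bounded (x : X) : compact [set: X] -> exists M : R, forall y, mdist x y <= M.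
Proof.
move=> cX; have [_ [M xM]] := bmeas_continuous cX (@mdist_continuous x).
by exists M => y; exact: le_trans (ler_norm _) (xM y).
Qed.

(** [delta s] bounds the error made when distances to the image of a cylinder are measured at its
    reference point. *)
Lemma cyl_radius (g : cantor_space -> X) : compact [set: X] -> continuous g ->
  exists delta : seq bool -> R,
    (forall s z, rbits z (size s) = s -> mdist (g (ext s)) (g z) <= delta s) /\
    (forall e, 0 < e -> exists n, forall s, size s = n -> delta s <= e).
Proof.
move=> cX cg.
pose S s := [set mdist (g (ext s)) (g z) | z in [set z | rbits z (size s) = s]].
exists (fun s => sup (S s)); split=> [s z zs|e e0].
  have [M gM] := mdist_bounded (g (ext s)) cX.
  by apply: ub_le_sup; [exists M => _ [z' _ <-]|exists z].
have [n gn] := cantor_modulus cg e0.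
exists n => s sn; apply: ge_sup.
  by exists (mdist (g (ext s)) (g (ext s))), (ext s) => //; exact: rbits_ext.
move=> _ [z /= zs <-]; rewrite ltW//.
have := gn (ext s) z; rewrite ballEmdist; apply.
by rewrite -{1}sn rbits_ext -sn zs.
Qed.

End mdist.

Lemma ler0_mul_addgt0 {R : realType} (x M : R) : 0 <= M ->
  (forall e, 0 < e -> x <= e * M) -> x <= 0.
Proof.
move=> M0 H; apply/ler_addgt0Pl => e' e0; rewrite addr0.
move: (e' : R) e0 => {e'} e e0.
(* [M] may be 0, hence the division by [M + 1]. *)
have M1 : 0 < M + 1 by rewrite ltr_wpDl.
apply: (le_trans (H (e / (M + 1)) _)); first exact: divr_gt0.
by rewrite mulrAC ler_pdivrMr// ler_pM2l// lerDl.
Qed.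

Section disintegration.
Context {R : realType} {d} {Om : measurableType d} {X : pmetricType R}.
Variables (P : {finite_measure set Om -> \bar R}) (c : Om -> borel X) (eps : R).
Variable L : (Om * X -> R) -> R.

(** Measurability is left out on purpose: [code] below is an arbitrary right inverse of [g], so the
    sets [cyl s] need not be Borel, and yet [L] is applied to their indicators. *)
Definition bfun (phi : Om * X -> R) := exists C : R, forall z, `|phi z| <= C.

Hypothesis LD : forall phi psi, bfun phi -> bfun psi ->
  L (fun z => phi z + psi z) = L phi + L psi.
Hypothesis LZ : forall a phi, bfun phi -> L (fun z => a * phi z) = a * L phi.
Hypothesis Lle : forall phi psi, bfun phi -> bmeas psi ->
  (forall w y, mdist (c w : X) y <= eps -> phi (w, y) <= psi w) ->
  L phi <= \int[P]_w psi w.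

Let fP : (P [set: Om] < +oo)%E.
Proof. by rewrite ltey_eq fin_num_measure. Qed.

Lemma bfunD phi psi : bfun phi -> bfun psi -> bfun (fun z => phi z + psi z).
Proof.
move=> [C phC] [C' psC]; exists (C + C') => z.
by rewrite (le_trans (ler_normD _ _))// lerD.
Qed.

Lemma bfunM phi psi : bfun phi -> bfun psi -> bfun (fun z => phi z * psi z).
Proof.
by move=> [C phC] [C' psC]; exists (C * C') => z; rewrite normrM ler_pM.
Qed.

Lemma bfun_cst r : bfun (cst r). Proof. by exists `|r|. Qed.

Let LN phi : bfun phi -> L (fun z => - phi z) = - L phi.
Proof.
by move=> bphi; rewrite -mulN1r -LZ//; congr L; apply/funext => z; rewrite mulN1r.
Qed.

Let bfunN phi : bfun phi -> bfun (fun z => - phi z).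
Proof. by move=> [C H]; exists C => z; rewrite normrN. Qed.

Let Lge phi psi : bfun phi -> bmeas psi ->
  (forall w y, mdist (c w : X) y <= eps -> psi w <= phi (w, y)) ->
  \int[P]_w psi w <= L phi.
Proof.
move=> bphi bpsi H; rewrite -lerN2 -LN// -bmeas_RintegralN//.
by apply: Lle; [exact: bfunN|exact: bmeasN|move=> w y wy; rewrite lerN2; exact: H].
Qed.

Let ind (A : set Om) (C : set X) : Om * X -> R := fun z => \1_A z.1 * \1_C z.2.

Let bfun_ind A C : bfun (ind A C).
Proof.
exists 1 => z; rewrite /ind !indicE.
by case: (_ \in A); case: (_ \in C); rewrite ?mulr1 ?mulr0 ?normr1 ?normr0.
Qed.

Let lam C A := L (ind A C).

Let lam_ge0 C A : 0 <= lam C A.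
Proof.
have <- : \int[P]_w (0 : R) = 0 by rewrite Rintegral_cst// mul0r.
apply: Lge; [exact: bfun_ind|exact: bmeas_cst|move=> w y _].
by rewrite /ind mulr_ge0.
Qed.

Let intind A : measurable A -> \int[P]_w \1_A w = fine (P A).
Proof. by move=> mA; rewrite Rintegral_indic// setIT. Qed.

Let lam_le C A : measurable A -> lam C A <= fine (P A).
Proof.
move=> mA; rewrite -intind//; apply: Lle; [exact: bfun_ind|exact: bmeas_indic|].
by move=> w y _; rewrite /ind /= ler_piMr// indicE; case: (_ \in _).
Qed.

Let lamT A : measurable A -> lam setT A = fine (P A).
Proof.
move=> mA; apply/eqP; rewrite eq_le lam_le//= -intind//.
apply: Lge; [exact: bfun_ind|exact: bmeas_indic|].
by move=> w y _; rewrite /ind /= indicT mulr1.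
Qed.

Let indicU T (A B : set T) x : A `&` B = set0 -> (\1_(A `|` B) x : R) = \1_A x + \1_B x.
Proof.
move=> AB; rewrite !indicE in_setU; have [Ax|] := boolP (x \in A); last by rewrite add0r.
rewrite (_ : (x \in B) = false) ?addr0//; apply/negbTE/negP => Bx.
have : (A `&` B) x by split; exact: set_mem.
by rewrite AB.
Qed.

Let lamU C A B : measurable A -> measurable B -> A `&` B = set0 ->
  lam C (A `|` B) = lam C A + lam C B.
Proof.
move=> mA mB AB; rewrite /lam -LD//; congr L; apply/funext => z.
by rewrite /ind indicU// mulrDl.
Qed.

Let lamC C D A : C `&` D = set0 -> lam (C `|` D) A = lam C A + lam D A.
Proof.
move=> CD; rewrite /lam -LD//; congr L; apply/funext => z.
by rewrite /ind indicU// mulrDr.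
Qed.

Hypothesis cX : compact [set: X].
Hypothesis mc : measurable_fun [set: Om] c.
Hypothesis eps0 : 0 <= eps.

Variables (g : cantor_space -> X) (code : X -> cantor_space).
Hypothesis cg : continuous g.
Hypothesis codeK : forall y, g (code y) = y.

Let cyl (s : seq bool) : set X := [set y | rbits (code y) (size s) = s].

Let cyl_split s : cyl s = cyl (false :: s) `|` cyl (true :: s).
Proof.
apply/seteqP; split=> [y /= ys|y /= [[_]|[_]]//].
by case E : (code y (size s)); [right|left]; exact: (congr2 cons E ys).
Qed.

Let cyl_disj s : cyl (false :: s) `&` cyl (true :: s) = set0.
Proof. apply/seteqP; split=> // y [H0 H1].
by have := esym (congr1 (head false) H0); rewrite (congr1 (head false) H1). Qed.

Let density_spec s (f : Om -> R) :=
  [/\ forall x, 0 <= f x, P.-integrable [set: Om] (EFin \o f) &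
      forall A, measurable A -> (lam (cyl s) A)%:E = (\int[P]_(x in A) (f x)%:E)%E].

Variable delta : seq bool -> R.
Hypothesis cyl_delta :
  forall s z, rbits z (size s) = s -> mdist (g (ext s)) (g z) <= delta s.
Hypothesis delta_small :
  forall e, 0 < e -> exists n, forall s, size s = n -> delta s <= e.

(** By the triangle inequality no point of the cylinder is within [eps] of a centre [c w] with [w]
    in [A], so the function vanishes at all the pairs on which a majorant is tested, and 0 is a
    majorant. *)
Let lam_far s A : measurable A ->
  (forall w, A w -> eps + delta s < mdist (c w : X) (g (ext s))) ->
  lam (cyl s) A = 0.
Proof.
move=> mA As; apply/eqP; rewrite eq_le lam_ge0 andbT.
have <- : \int[P]_w (0 : R) = 0 by rewrite Rintegral_cst// mul0r.
apply: Lle; [exact: bfun_ind|exact: bmeas_cst|move=> w y wy].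
rewrite /ind /= !indicE; have [Aw|] := boolP (w \in A); last by rewrite mul0r.
have [ys|] := boolP (y \in cyl s); last by rewrite mulr0.
have /As := set_mem Aw; have := cyl_delta (set_mem ys); rewrite codeK.
have := metric_triangle (c w : X) y (g (ext s)); rewrite (metric_sym y); lra.
Qed.

(** Each tree identity holds after integration over every measurable set, hence almost everywhere
    for the densities. Words are countable, so a single null set [N] serves them all. *)
Lemma disintegration_density : exists (p : seq bool -> Om -> R) (N : set Om),
  [/\ measurable N, P N = 0%E,
    (forall s, bmeas (p s)) /\ (forall w, ~ N w -> tree_mass (p ^~ w)),
    forall w s, ~ N w -> eps + delta s < mdist (c w : X) (g (ext s)) -> p s w = 0 &
    forall s A, measurable A -> \int[P]_(w in A) p s w = lam (cyl s) A].
Proof.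
have /choice[f fP'] s : exists f, density_spec s f.
  by apply: dominated_density => *; [exact: lam_ge0|exact: lam_le|exact: lamU].
have f0 s w : 0 <= f s w by case: (fP' s) => + _ _; exact.
have fint s : P.-integrable [set: Om] (EFin \o f s) by case: (fP' s).
have fintS s E : measurable E -> P.-integrable E (fun w => (f s w)%:E).
  by move=> mE; exact: integrableS measurableT mE (@subsetT _ _) (fint s).
have mf s : measurable_fun [set: Om] (f s).
  by apply/measurable_EFinP; exact: measurable_int (fint s).
have flam s A : measurable A -> (\int[P]_(x in A) (f s x)%:E)%E = (lam (cyl s) A)%:E.
  by move=> mA; case: (fP' s) => _ _ ->.
have ae_seq (Q : seq bool -> Om -> Prop) :
    (forall s, {ae P, forall w, Q s w}) -> {ae P, forall w, forall s, Q s w}.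
  move=> HQ; pose Q' n w := if unpickle n is Some s then Q s w else True.
  have : {ae P, forall w, forall n, Q' n w}.
    by apply: ae_foralln => n; rewrite /Q'; case: unpickle => // ; exact: aeW.
  by apply: filterS => w H s; have := H (pickle s); rewrite /Q' pickleK.
have ae1 : {ae P, forall w, f [::] w = 1}.
  have : ae_eq P [set: Om] (EFin \o f [::]) (cst 1%E).
    apply: integral_ae_eq => // E _ mE; rewrite flam// integral_cst// mul1e.
    rewrite (_ : cyl [::] = setT); last by apply/seteqP; split.
    by rewrite lamT// fineK// fin_num_measure.
  by apply: filterS => w /= /(_ Logic.I)[].
have ae2 : {ae P, forall w, forall s, f s w = f (false :: s) w + f (true :: s) w}.
  apply: ae_seq => s.
  have : ae_eq P [set: Om] (EFin \o f s)
      (fun w => (f (false :: s) w)%:E + (f (true :: s) w)%:E)%E.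
    apply: integral_ae_eq => //.
      by apply: emeasurable_funD; apply/measurable_EFinP.
    move=> E _ mE; rewrite integralD//; [|exact: fintS|exact: fintS].
    by rewrite !flam// -EFinD cyl_split lamC// cyl_disj.
  by move=> H; apply: (filterS _ H) => w /(_ Logic.I) [].
pose far s := [set w | eps + delta s < mdist (c w : X) (g (ext s))].
have mfar s : measurable (far s).
  rewrite (_ : far s = c @^-1` (~` cball (g (ext s)) (eps + delta s))).
    rewrite -[X in measurable X]setTI; apply: mc => //.
    by apply: measurableC; apply: borel_closed_measurable; exact: cball_closed.
  apply/seteqP; split=> w; rewrite /far /cball /= metric_sym.
    by rewrite ltNge => /negP.
  by move=> /negP; rewrite ltNge.
have ae3 : {ae P, forall w, forall s, far s w -> f s w = 0}.
  apply: ae_seq => s.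
  have : ae_eq P (far s) (EFin \o f s) (cst 0%E).
    apply: integral_ae_eq => //; first exact: fintS.
    by move=> E Efar mE; rewrite flam// integral_cst// mul0e lam_far.
  by move=> H; apply: (filterS _ H) => w {}H /H [].
have : {ae P, forall w, [/\ f [::] w = 1,
    forall s, f s w = f (false :: s) w + f (true :: s) w &
    forall s, far s w -> f s w = 0]}.
  by apply: filterS (filterI ae1 (filterI ae2 ae3)) => w [? [? ?]]; split.
move=> [N [mN PN0 goodN]].
have {}goodN w : ~ N w -> [/\ f [::] w = 1,
    forall s, f s w = f (false :: s) w + f (true :: s) w &
    forall s, far s w -> f s w = 0].
  by move=> Nw; apply: contrapT => H; apply: Nw; exact: goodN.
(* A density is only integrable; cut off on [N] it is bounded by 1, being the mass of a node in a
   tree of total mass 1. *)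
pose p s w := f s w * \1_(~` N) w.
have pf s w : ~ N w -> p s w = f s w.
  by move=> Nw; rewrite /p indicE mem_set ?mulr1.
have pN s w : N w -> p s w = 0.
  by move=> Nw; rewrite /p indicE memNset ?mulr0//; exact.
have tm w : ~ N w -> tree_mass (p ^~ w).
  move=> Nw; have [f1 fD _] := goodN _ Nw.
  by split=> [|s|s]; rewrite !pf.
exists p, N; split=> //.
- split=> // s; split.
    apply: measurable_funM => //; apply: measurable_indic; exact: measurableC.
  exists 1 => w; have [Nw|Nw] := pselect (N w); first by rewrite pN// normr0.
  have [l0 l1] := lo_bounds s (tm _ Nw); have [_ p0 _] := tm _ Nw.
  by have := p0 s; rewrite /= => ps; rewrite ger0_norm//; lra.
- by move=> w s Nw ws; rewrite pf//; have [_ _] := goodN _ Nw; exact.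
- move=> s A mA; transitivity (fine (\int[P]_(x in A) (f s x)%:E)%E); last by rewrite flam.
  congr fine; apply: ae_eq_integral => //.
  + apply/measurable_EFinP; apply: measurable_funTS; apply: measurable_funM => //.
    by apply: measurable_indic; exact: measurableC.
  + by apply/measurable_EFinP; exact: measurable_funTS.
  + exists N; split=> // w /= H; apply: contrapT => Nw; apply: H => _.
    by rewrite pf.
Qed.

Theorem disintegration : exists m : R.-pker Om ~> borel X,
  (forall w, m w (~` cball (c w : X) eps) = 0%E) /\
  forall A (v : X -> R), measurable A -> continuous v ->
    L (fun z => \1_A z.1 * v z.2) = \int[P]_(w in A) \int[m w]_y v y.
Proof.
have [p [N [mN PN0 [bp tm] pfar plam]]] := disintegration_density.
have mp s : measurable_fun [set: Om] (p s) by case: (bp s).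
exists (tree_pker mp cg mc mN); split=> [w|A v mA cv].
  exact: (tree_pker_cball mp cg mc mN tm eps0 cyl_delta delta_small).
set m := tree_pker _ _ _ _.
have bv : bmeas (v : borel X -> R) by exact: bmeas_continuous.
have bm := bmeas_pker m bv.
set I := \int[P]_(w in A) _.
have [M ME] : exists M, fine (P [set: Om]) = M by exists (fine (P [set: Om])).
have M0 : 0 <= M by rewrite -ME fine_ge0.
have EM e : \int[P]_w e = e * M by rewrite Rintegral_cst// ME.
have ce e : 0 < e -> \int[P]_(w in A) e <= e * M.
  move=> e0; rewrite Rintegral_cst// ler_pM2l// -ME fine_le ?fin_num_measure//.
  by rewrite le_measure ?inE.
clear ME.
(* Both sides are compared with [J], in which [v] is replaced by a step function on the cylinders of
   depth [n]. Each comparison costs [e * M], hence the factor 2. *)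
suff H (e : R) : 0 < e -> `|L (fun z => \1_A z.1 * v z.2) - I| <= e * (M * 2).
  apply/eqP; rewrite -subr_eq0 -normr_eq0 eq_le normr_ge0 andbT.
  by apply: ler0_mul_addgt0 H; rewrite mulr_ge0.
move=> e0.
have cvg : continuous (v \o g).
  by move=> z; apply: continuous_comp; [exact: cg|exact: cv].
have [n vgn] := cantor_modulus cvg e0.
have {}vgn z z' : rbits z n = rbits z' n -> `|v (g z) - v (g z')| <= e.
  by move=> /vgn; rewrite /ball /= => /ltW.
pose F w := \sum_(s : n.-tuple bool) v (g (ext s)) * p s w.
have bF : bmeas F by apply: bmeas_sum => s; exact: bmeasZ.
pose J := \int[P]_(w in A) F w.
have be : bmeas (cst e : Om -> R) by exact: bmeas_cst.
have IJ : `|I - J| <= e * M.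
  have mF : {ae P, forall w, A w -> `|\int[m w]_y v y - F w| <= e}.
    exists N; split=> // w /= H; apply: contrapT => Nw; apply: H => _.
    exact: (tree_pker_Rintegral mp cg mc mN tm cX cv Nw vgn).
  have H1 : I <= J + e * M.
    apply: (@le_trans _ _ (J + \int[P]_(w in A) e)); last by rewrite lerD2l ce.
    rewrite -bmeas_RintegralD//.
    apply: bmeas_le_Rintegral_ae => //; first exact: bmeasD.
    by apply: filterS mF => w H Aw; have := H Aw; rewrite ler_norml; lra.
  have H2 : J <= I + e * M.
    apply: (@le_trans _ _ (I + \int[P]_(w in A) e)); last by rewrite lerD2l ce.
    rewrite -bmeas_RintegralD//.
    apply: bmeas_le_Rintegral_ae => //; first exact: bmeasD.
    by apply: filterS mF => w H Aw; have := H Aw; rewrite ler_norml; lra.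
  by rewrite ler_norml; apply/andP; split; lra.
pose phi (z : Om * X) := \sum_(s : n.-tuple bool) v (g (ext s)) * ind A (cyl s) z.
have bphi' (s : n.-tuple bool) : bfun (fun z => v (g (ext s)) * ind A (cyl s) z).
  by apply: bfunM; [exact: bfun_cst|exact: bfun_ind].
(* Among the words of length [n], only the prefix of the code of [z.2] contributes. *)
have phiE z : phi z = \1_A z.1 * v (g (ext (rbits (code z.2) n))).
  have sB : size (rbits (code z.2) n) == n by rewrite size_rbits.
  rewrite /phi (bigD1 (Tuple sB))//= big1 ?addr0.
    rewrite mulrC; congr (_ * _); rewrite /ind indicE [X in _ * X]indicE.
    by rewrite (_ : (z.2 \in cyl _) = true) ?mulr1//; apply/mem_set; rewrite /cyl /= size_rbits.
  move=> s sn; rewrite /ind [X in _ * (_ * X)]indicE (_ : (_ \in _) = false) ?mulr0//.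
  apply/negbTE; apply: contraNN sn => /set_mem; rewrite /cyl /= size_tuple => sz.
  by rewrite -val_eqE /= sz.
have phiJ : L phi = J.
  have -> : J = \sum_(s : n.-tuple bool) v (g (ext s)) * lam (cyl s) A.
    rewrite /J bmeas_Rintegral_sum//; last by move=> s; exact: bmeasZ.
    by apply: eq_bigr => s _; rewrite bmeas_RintegralZ// plam.
  have : forall r : seq (n.-tuple bool),
      bfun (fun z => \sum_(s <- r) v (g (ext s)) * ind A (cyl s) z) /\
      L (fun z => \sum_(s <- r) v (g (ext s)) * ind A (cyl s) z) =
        \sum_(s <- r) v (g (ext s)) * lam (cyl s) A.
    elim=> [|s r [bIH IH]].
      rewrite [X in bfun X](_ : _ = cst 0); last by apply/funext => z; rewrite big_nil.
      rewrite [X in L X](_ : _ = cst 0); last by apply/funext => z; rewrite big_nil.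
      split; first exact: bfun_cst.
      rewrite big_nil -[RHS](mul0r (L (cst 0))) -LZ; last exact: bfun_cst.
      by congr L; apply/funext => z; rewrite mul0r.
    pose psi z := v (g (ext s)) * ind A (cyl s) z + \sum_(s <- r) v (g (ext s)) * ind A (cyl s) z.
    rewrite [X in bfun X](_ : _ = psi); last by apply/funext => z; rewrite big_cons.
    rewrite [X in L X](_ : _ = psi); last by apply/funext => z; rewrite big_cons.
    by rewrite big_cons; split; [exact: bfunD|rewrite LD// IH LZ].
  by move=> /(_ (index_enum _))[].
have LJ : `|L (fun z => \1_A z.1 * v z.2) - J| <= e * M.
  have [_ [C vC]] := bv.
  have b1 : bfun (fun z => \1_A z.1 * v z.2).
    apply: bfunM.
      by exists 1 => z; rewrite indicE; case: (_ \in _); rewrite ?normr1 ?normr0.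
    by exists C => z; exact: vC.
  have b2 : bfun (fun z => -1 * phi z).
    apply: bfunM; first exact: bfun_cst.
    exists C => z; rewrite phiE normrM -[C]mul1r ler_pM//.
    by rewrite indicE; case: (_ \in _); rewrite ?normr1 ?normr0.
  have b3 : bfun phi.
    exists C => z; rewrite phiE normrM -[C]mul1r ler_pM//.
    by rewrite indicE; case: (_ \in _); rewrite ?normr1 ?normr0.
  have -> : L (fun z => \1_A z.1 * v z.2) - J = L (fun z => \1_A z.1 * v z.2 + -1 * phi z).
    by rewrite LD// LZ// phiJ mulN1r.
  have close z : `|\1_A z.1 * v z.2 + -1 * phi z| <= e.
    rewrite phiE mulN1r -mulrBr normrM -[e]mul1r ler_pM//.
      by rewrite indicE; case: (_ \in _); rewrite ?normr1 ?normr0.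
    rewrite -{1}(codeK z.2); apply: vgn.
    by have := rbits_ext (rbits (code z.2) n); rewrite size_rbits => ->.
  have b4 : bfun (fun z => \1_A z.1 * v z.2 + -1 * phi z) by exact: bfunD.
  rewrite ler_norml; apply/andP; split.
    rewrite -EM -bmeas_RintegralN//; apply: Lge => //; first exact: bmeasN.
    by move=> w y _; have := close (w, y); rewrite ler_norml => /andP[].
  rewrite -EM; apply: Lle => // w y _.
  by have := close (w, y); rewrite ler_norml => /andP[].
have := ler_distD J (L (fun z => \1_A z.1 * v z.2)) I.
by rewrite (distrC J); lra.
Qed.

End disintegration.

(** * A Strassen theorem *)

Lemma disintegration_compact {R : realType} {d} {Om : measurableType d}
    {X : pmetricType R} (P : {finite_measure set Om -> \bar R})
    (c : Om -> borel X) (eps : R) (L : (Om * X -> R) -> R) :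
  (forall phi psi, bfun phi -> bfun psi ->
    L (fun z => phi z + psi z) = L phi + L psi) ->
  (forall a phi, bfun phi -> L (fun z => a * phi z) = a * L phi) ->
  (forall phi psi, bfun phi -> bmeas psi ->
    (forall w y, mdist (c w : X) y <= eps -> phi (w, y) <= psi w) ->
    L phi <= \int[P]_w psi w) ->
  compact [set: X] -> measurable_fun [set: Om] c -> 0 <= eps ->
  exists m : R.-pker Om ~> borel X,
    (forall w, m w (~` cball (c w : X) eps) = 0%E) /\
    forall A (v : X -> R), measurable A -> continuous v ->
      L (fun z => \1_A z.1 * v z.2) = \int[P]_(w in A) \int[m w]_y v y.
Proof.
move=> LD LZ Lle cX mc eps0.
have [g cg] := cantor_surj cX (@metric_hausdorff _ X).
have gsurj y : exists z, g z = y.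
  by have [z _ gz] := @surj _ _ _ _ g y Logic.I; exists z.
have [code codeK] := choice gsurj.
have [delta [d1 d2]] := cyl_radius cX cg.
exact: (disintegration LD LZ Lle cX mc eps0 cg codeK d1 d2).
Qed.

(** In the application [A0] and [A1] are the two label sets in X x {0,1} and [c] is the projection
    to X. The sign turns a bound from below by the minimum over the ball into a bound from above by
    a maximum, so that one kernel serves both terms. *)
Theorem strassen_signed {R : realType} {d} {Om : measurableType d}
    {X : pmetricType R} (P : {finite_measure set Om -> \bar R})
    (c : Om -> borel X) (eps : R) (A0 A1 : set Om) (M : (X -> R) -> R) :
  compact [set: X] -> measurable_fun [set: Om] c -> 0 <= eps ->
  measurable A0 -> measurable A1 ->
  (forall v v' : X -> R, continuous v -> continuous v' ->
    M (fun y => v y + v' y) = M v + M v') ->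
  (forall a (v : X -> R), continuous v -> M (fun y => a * v y) = a * M v) ->
  (forall (v : X -> R) psi, continuous v -> bmeas psi ->
    (forall w y, mdist (c w : X) y <= eps ->
      (\1_A0 w - \1_A1 w) * v y <= psi w) ->
    M v <= \int[P]_w psi w) ->
  exists m : R.-pker Om ~> borel X,
    (forall w, m w (~` cball (c w : X) eps) = 0%E) /\
    forall v : X -> R, continuous v ->
      M v = \int[P]_(w in A0) \int[m w]_y v y - \int[P]_(w in A1) \int[m w]_y v y.
Proof.
move=> cX mc eps0 mA0 mA1 MD MZ Mle.
have fP : (P [set: Om] < +oo)%E by rewrite ltey_eq fin_num_measure.
pose E : lmodType R := (Om * X -> R^o).
(* The numbers [s] are the integrals of all measurable majorants over the ball; no infimum is taken,
   and the supremum of [phi] over the ball, possibly not measurable, never appears. An unbounded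
   [phi] has no entry. *)
pose Q (phi : E) (s : R) := bfun phi /\ exists psi : Om -> R,
  [/\ bmeas psi, forall w y, mdist (c w : X) y <= eps -> phi (w, y) <= psi w &
      s = \int[P]_w psi w].
have cQ : major_cone Q.
  split.
  - split; first exact: (bfun_cst 0).
    exists (cst 0); split => //; first exact: bmeas_cst.
    by rewrite Rintegral_cst// mul0r.
  - move=> phi phi' r s [bphi [psi [bpsi H ->]]] [bphi' [psi' [bpsi' H' ->]]].
    split; first exact: bfunD.
    exists (fun w => psi w + psi' w); split; first exact: bmeasD.
      by move=> w y wy; apply: lerD; [exact: H|exact: H'].
    by rewrite bmeas_RintegralD.
  - move=> a phi s a0 [bphi [psi [bpsi H ->]]].
    split; first by apply: (bfunM (bfun_cst a) bphi).
    exists (fun w => a * psi w); split; first exact: bmeasZ.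
      by move=> w y wy; rewrite ler_pM2l//; exact: H.
    by rewrite bmeas_RintegralZ.
pose sg w : R := \1_A0 w - \1_A1 w.
have bv (v : X -> R) : continuous v -> bfun (fun z : Om * X => v z.2).
  by move=> cv; have [_ [C vC]] := bmeas_continuous cX cv; exists C => z; exact: vC.
have b1 A : bfun (fun z : Om * X => \1_A z.1).
  by exists 1 => z; rewrite indicE; case: (_ \in _); rewrite ?normr1 ?normr0.
have b1v A (v : X -> R) : continuous v -> bfun (fun z : Om * X => \1_A z.1 * v z.2).
  by move=> cv; apply: bfunM => //; exact: bv.
have bsg (v : X -> R) : continuous v -> bfun (fun z : Om * X => sg z.1 * v z.2).
  move=> cv; apply: bfunM; last exact: bv.
  have [C0 H0] := b1 A0; have [C1 H1] := b1 A1.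
  by exists (C0 + C1) => z; rewrite (le_trans (ler_normB _ _))// lerD.
(* Distinct [v] may have the same image, for instance when [sg] vanishes; working with a graph, that
   [M] depends only on the image is a consequence of domination. *)
pose G0 : set (E * R) := [set p | exists v : X -> R, [/\ continuous v,
  p.1 = (fun z => sg z.1 * v z.2) & p.2 = M v]].
have lG0 : linear_graph G0.
  split.
  - exists (cst 0); split => //=.
    + exact: cst_continuous.
    + by apply/funext => z; rewrite mulr0.
    + rewrite -[LHS](mul0r (M (cst 0))) -MZ; last exact: cst_continuous.
      by congr M; apply/funext => z; rewrite mul0r.
  - move=> p q [v [cv p1 p2]] [v' [cv' q1 q2]]; exists (fun y => v y + v' y); split => /=.
    + by move=> y; apply: continuousD; [exact: cv|exact: cv'].
    + by rewrite p1 q1; apply/funext => z /=; rewrite mulrDr.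
    + by rewrite p2 q2 MD.
  - move=> a p [v [cv p1 p2]]; exists (fun y => a * v y); split => /=.
    + by move=> y; apply: continuousM; [exact: cst_continuous|exact: cv].
    + by rewrite p1; apply/funext => z /=; rewrite mulrCA.
    + by rewrite p2 MZ.
have G0Q : graph_le G0 Q.
  move=> phi r s [v [cv /= -> ->]] [_ [psi [bpsi H ->]]].
  exact: Mle.
have [L [LD LZ Lle LG]] := hahn_banach_cone cQ lG0 G0Q.
have BQ (phi : E) : bfun phi -> exists s t, Q phi s /\ Q (- phi) t.
  move=> bphi; have [C phC] := bphi.
  have bC : bmeas (cst C : Om -> R) by exact: bmeas_cst.
  exists (\int[P]_w C), (\int[P]_w C); split; split => //.
  - by exists (cst C); split => // w y _; exact: le_trans (ler_norm _) (phC _).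
  - by exists C => z; rewrite normrN.
  - exists (cst C); split => // w y _.
    by apply: le_trans (ler_norm _) _; rewrite normrN.
have LD' phi psi : bfun phi -> bfun psi ->
  L (fun z => phi z + psi z) = L phi + L psi.
  by move=> bphi bpsi; apply: LD; exact: BQ.
have LZ' a phi : bfun phi -> L (fun z => a * phi z) = a * L phi.
  by move=> bphi; apply: LZ; exact: BQ.
have Lle' phi psi : bfun phi -> bmeas psi ->
    (forall w y, mdist (c w : X) y <= eps -> phi (w, y) <= psi w) ->
    L phi <= \int[P]_w psi w.
  by move=> bphi bpsi H; apply: Lle; [exact: BQ|split=> //; exists psi].
have [m [m0 mL]] := disintegration_compact LD' LZ' Lle' cX mc eps0.
exists m; split=> // v cv.
rewrite -!mL//.
rewrite -(LG (fun z => sg z.1 * v z.2) (M v)); [|by apply: BQ; exact: bsg|by exists v].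
pose f A := fun z : Om * X => \1_A z.1 * v z.2.
have -> : L (f A0) - L (f A1) = L (f A0) + -1 * L (f A1) by rewrite mulN1r.
rewrite -LZ'; last exact: b1v.
rewrite -LD'; [|exact: b1v|by apply: (bfunM (bfun_cst _)); exact: b1v].
by congr L; apply/funext => z; rewrite /sg /f mulrBl mulN1r.
Qed.

(** * Measures on a compact metric space are determined by continuous functions *)

Section dist_to_complement.
Context {R : realType} {X : pmetricType R}.
Variables (F : set X).
Hypothesis F0 : F !=set0.

Definition dist_set (x : X) : R := inf [set mdist x y | y in F].

Lemma has_inf_dist x : has_inf [set mdist x y | y in F].
Proof.
split; first by have [y Fy] := F0; exists (mdist x y), y.
by exists 0 => _ [y _ <-]; exact: mdist_ge0.
Qed.

Lemma dist_set_ge0 x : 0 <= dist_set x.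
Proof.
by apply: lb_le_inf; [case: (has_inf_dist x)|move=> _ [y _ <-]; exact: mdist_ge0].
Qed.

Lemma dist_set_lip x y : dist_set x <= mdist x y + dist_set y.
Proof.
rewrite -lerBlDl; apply: lb_le_inf; first by case: (has_inf_dist y).
move=> _ [z Fz <-]; rewrite lerBlDl.
apply: (@le_trans _ _ (mdist x z)); last exact: metric_triangle.
by apply: ge_inf; [case: (has_inf_dist x)|exists z].
Qed.

Lemma dist_set_continuous : continuous dist_set.
Proof.
move=> x; apply/cvgrPdist_le => e e0.
have := nbhsx_ballx x e e0; apply: filterS => z; rewrite ballEmdist /= => xz.
have := dist_set_lip x z; have := dist_set_lip z x.
by rewrite (metric_sym z x) ler_norml => ? ?; apply/andP; split; lra.
Qed.

Lemma dist_set_in x : F x -> dist_set x = 0.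
Proof.
move=> Fx; apply/eqP; rewrite eq_le dist_set_ge0 andbT -(mdistxx x).
by apply: ge_inf; [case: (has_inf_dist x)|exists x].
Qed.

Lemma dist_set_gt0 x : closed F -> ~ F x -> 0 < dist_set x.
Proof.
move=> cF Fx; have : nbhs x (~` F) by apply: open_nbhs_nbhs; split => //; exact: closed_openC.
move=> /nbhs_ballP[e /= e0 eF]; apply: (lt_le_trans e0).
apply: lb_le_inf; first by case: (has_inf_dist x).
move=> _ [y Fy <-]; rewrite leNgt; apply/negP => xy.
by apply: (eF y) => //; rewrite ballEmdist.
Qed.

End dist_to_complement.

(** The indicator of an open [U] is the pointwise limit of the continuous functions min(1, n d(x, X
    \ U)), so the two measures agree on open sets by dominated convergence; these are stable under
    intersection and generate the Borel sets. *)
Lemma eq_measure_continuous {R : realType} {X : pmetricType R}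
    (a b : {measure set (borel X) -> \bar R}) :
  compact [set: X] -> (a [set: borel X] < +oo)%E -> (b [set: borel X] < +oo)%E ->
  (forall v : X -> R, continuous v -> \int[a]_x v x = \int[b]_x v x) ->
  forall A : set (borel X), measurable A -> a A = b A.
Proof.
move=> cX fa fb ab.
have abT : a [set: borel X] = b [set: borel X].
  have := ab (cst 1) (@cst_continuous _ _ _); rewrite !Rintegral_cst// !mul1r => E.
  by rewrite -(fineK (_ : a setT \is a fin_num)) ?ge0_fin_numE// E fineK ?ge0_fin_numE.
have abU (U : set X) : open U -> a U = b U.
  (* The whole space is set apart because its complement is empty, and the infimum defining the
     distance to it would be the default 0. *)
  move=> oU; have [->//|/eqP UT] := eqVneq U setT.
  have CU0 : ~` U !=set0.
    apply/set0P; apply/negP => /eqP CU; apply: UT.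
    by rewrite -(setCK U) CU setC0.
  have mU : measurable (U : set (borel X)) by exact: borel_open_measurable.
  pose f n (x : X) : R := Num.min 1 (n%:R * dist_set (~` U) x).
  have cf n : continuous (f n).
    move=> x; apply: (@continuous_min R X (cst 1) (fun x => n%:R * dist_set (~` U) x) x).
      exact: cst_continuous.
    by apply: continuousM; [exact: cst_continuous|exact: dist_set_continuous].
  have f0 n x : 0 <= f n x.
    by rewrite le_min ler01 mulr_ge0// dist_set_ge0.
  have f1 n x : f n x <= 1 by rewrite ge_min lexx.
  have fU x : (f n x)%:E @[n --> \oo] --> ((\1_U x)%:E : \bar R).
    apply: cvg_EFin; first exact: nearW.
    rewrite indicE; have [Ux|Ux] := boolP (x \in U); last first.
      have -> : fine \o (fun n => (f n x)%:E) = cst 0.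
        apply/funext => n /=; rewrite /f dist_set_in//; last by move=> /mem_set; exact/negP.
        by rewrite mulr0 min_r.
      exact: cvg_cst.
    have d0 : 0 < dist_set (~` U) x.
      apply: dist_set_gt0 => //; first exact: open_closedC.
      by move=> /(_ (set_mem Ux)).
    apply: cvg_near_cst; near=> n; rewrite /= /f min_l//.
    rewrite -ler_pdivrMr//; near: n; exact: nbhs_infty_ger.
  have lim (m : {measure set (borel X) -> \bar R}) : (m [set: borel X] < +oo)%E ->
      (\int[m]_x (f n x)%:E)%E @[n --> \oo] --> m U.
    move=> fm; rewrite -[X in _ --> X](_ : (\int[m]_x (\1_U x)%:E)%E = _).
      apply: (@dominated_cvg _ _ _ m setT measurableT _ _ (cst 1%E)) => //.
      - by move=> n; apply/measurable_EFinP; case: (bmeas_continuous cX (cf n)).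
      - exact: (bmeas_integrable fm measurableT (bmeas_cst 1)).
      - by move=> n x _ /=; rewrite lee_fin ger0_norm.
    by rewrite integral_indic// setIT.
  apply: (cvg_unique _ (lim a fa)); first exact: ereal_hausdorff.
  rewrite (_ : (fun n => _) = (fun n => (\int[b]_x (f n x)%:E)%E)); first exact: lim.
  apply/funext => n; have bf := bmeas_continuous cX (cf n).
  by rewrite -!bmeas_EFin// ab.
move=> A mA; apply: (@g_sigma_algebra_measure_unique _ R (borel X) (@open X) _
  (fun=> setT) _ _ a b) => //.
- by move=> U; exact: borel_open_measurable.
- by move=> _; exact: openT.
- by rewrite bigcup_const//; exists 0%N.
- exact: openI.
Unshelve. all: by end_near. Qed.

(** * Ball maxima, mixtures and supports *)

Section ball_max.
Context {R : realType} {X : pmetricType R}.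
Variable eps : R.
Hypothesis eps0 : 0 < eps.
Hypothesis cX : compact [set: X].
Implicit Types v : X -> R.

Lemma ball_max_ge v x y : continuous v -> mdist x y <= eps -> v y <= ball_max eps v x.
Proof. by move=> cv xy; have [z xz [-> zmax]] := ball_maxP x eps0 cX cv; exact: zmax. Qed.

Lemma ball_max_le v x r : continuous v ->
  (forall y, mdist x y <= eps -> v y <= r) -> ball_max eps v x <= r.
Proof. by move=> cv H; have [z xz [-> _]] := ball_maxP x eps0 cX cv; exact: H. Qed.

Lemma ball_minE v x : continuous v -> ball_min eps v x = - ball_max eps (fun y => - v y) x.
Proof.
move=> cv; have cNv : continuous (fun y => - v y).
  by move=> y; apply: continuousN; exact: cv.
have [z xz [-> zmin]] := ball_minP x eps0 cX cv.
have [z' xz' [-> zmax]] := ball_maxP x eps0 cX cNv.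
by apply/eqP; rewrite eq_le opprK zmin//= -lerN2 zmax.
Qed.

(** Upper semicontinuity, whence Borel measurability of the ball maximum. Each [y] satisfies
    [v y < r], which persists for nearby points, or is at distance more than [eps] from [x], which
    persists when both points move; compactness makes the neighbourhood of [x] uniform in [y]. *)
Lemma open_ball_max_lt v r : continuous v -> open [set x | ball_max eps v x < r].
Proof.
move=> cv; rewrite openE => x /= xr; rewrite /interior.
have : \forall x' \near x, [set: X] `<=` (fun y => mdist x' y <= eps -> v y < r).
  apply: ((compact_near_coveringP _).1 cX X (nbhs x) (fun x' y => mdist x' y <= eps -> v y < r)).
  move=> y _.
  have [vy|vy] := ltP (v y) r.
    exists ([set y' | v y' < r], setT) => /=; last by move=> [y' x'] /= [].
    split; last exact: filterT.
    have : open (v @^-1` `]-oo, r[%classic) by apply: open_comp => // *; exact: cv.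
    by move=> oV; apply: (@open_nbhs_nbhs _ y); split.
  have xy : eps < mdist x y.
    by rewrite ltNge; apply/negP => /(ball_max_ge cv); rewrite leNgt (lt_le_trans xr).
  pose e := (mdist x y - eps) / 2; have e0 : 0 < e by rewrite divr_gt0// subr_gt0.
  exists (ball y e, ball x e) => /=; first by split; exact: nbhsx_ballx.
  move=> [y' x'] /= []; rewrite !ballEmdist /= => yy' xx' x'y'.
  have := metric_triangle x x' y; have := metric_triangle x' y' y.
  by rewrite (metric_sym y' y) /e in yy' xx' *; lra.
apply: filterS => x' H; have [z xz [E _]] := ball_maxP x' eps0 cX cv.
by rewrite /= E; exact: H.
Qed.

Lemma bmeas_ball_max v : continuous v -> bmeas (ball_max eps v : borel X -> R).
Proof.
move=> cv; split.
  have mle r : measurable [set x : borel X | r <= ball_max eps v x].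
    rewrite (_ : mkset _ = ~` [set x | ball_max eps v x < r]).
      by apply: measurableC; apply: borel_open_measurable; exact: open_ball_max_lt.
    by apply/seteqP; split=> x /=; rewrite leNgt => /negP.
  apply: (measurability _ (RGenCInfty.measurableE R)).
  move=> _ [_ [a ->] <-]; rewrite setTI.
  rewrite (_ : _ @^-1` _ = [set x | a <= ball_max eps v x])//.
  by apply/seteqP; split => x /=; rewrite in_itv/= andbT.
have [_ [C vC]] := bmeas_continuous cX cv.
by exists C => x; have [z _ [-> _]] := ball_maxP x eps0 cX cv; exact: vC.
Qed.

Lemma bmeas_ball_min v : continuous v -> bmeas (ball_min eps v : borel X -> R).
Proof.
move=> cv; rewrite (_ : ball_min eps v = fun x => - ball_max eps (fun y => - v y) x).
  by apply: bmeasN; apply: bmeas_ball_max => y; apply: continuousN; exact: cv.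
by apply/funext => x; exact: ball_minE.
Qed.

End ball_max.

Section kernel_mixture.
Context {R : realType} {d d'} {T : measurableType d} {T' : measurableType d'}.
Variables (rho : {finite_measure set T -> \bar R}) (m : R.-pker T ~> T').

(** A measure is a kernel from the one-point space. The mixture is then a composition of kernels,
    which yields both its countable additivity and its integral formula. *)
Let rhoc (_ : unit) : {measure set T -> \bar R} := rho.

Let mrhoc U : measurable U -> measurable_fun [set: unit] (rhoc ^~ U).
Proof. by move=> _; exact: measurable_cst. Qed.

HB.instance Definition _ := isKernel.Build _ _ unit T R rhoc mrhoc.

Let rhoc_uub : measure_fam_uub rhoc.
Proof.
exists (fine (rho [set: T]) + 1) => _ /=.
by rewrite /rhoc EFinD fineK ?fin_num_measure// lteDl ?fin_num_measure// lte01.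
Qed.

HB.instance Definition _ := Kernel_isFinite.Build _ _ unit T R rhoc rhoc_uub.

Let msnd (z : unit * T) : {measure set T' -> \bar R} := m z.2.

Let mmsnd U : measurable U -> measurable_fun [set: unit * T] (msnd ^~ U).
Proof. by move=> mU; exact: measurableT_comp (measurable_kernel m _ mU) measurable_snd. Qed.

HB.instance Definition _ := isKernel.Build _ _ (unit * T)%type T' R msnd mmsnd.

Let msnd1 z : msnd z [set: T'] = 1%E. Proof. exact: prob_kernel. Qed.

HB.instance Definition _ := Kernel_isProbability.Build _ _ (unit * T)%type T' R msnd msnd1.

Definition kmix : {measure set T' -> \bar R} := mkcomp rhoc msnd tt.

Lemma kmixE A : kmix A = (\int[rho]_x m x A)%E. Proof. by []. Qed.

Lemma kmixT : kmix [set: T'] = rho [set: T].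
Proof.
rewrite kmixE (eq_integral (cst 1%E)); last by move=> x _; rewrite prob_kernel.
by rewrite integral_cst// mul1e.
Qed.

Lemma kmix_lty : (kmix [set: T'] < +oo)%E.
Proof. by rewrite kmixT ltey_eq fin_num_measure. Qed.

Lemma Rintegral_kmix (v : T' -> R) : bmeas v ->
  \int[kmix]_y v y = \int[rho]_x \int[m x]_y v y.
Proof.
move=> bv; have [_ [C vC]] := bv.
have frho : (rho [set: T] < +oo)%E by rewrite ltey_eq fin_num_measure.
have bC : bmeas (cst C : T' -> R) by exact: bmeas_cst.
have bvC := bmeasD bv bC.
have H : \int[kmix]_y (v y + C) = \int[rho]_x \int[m x]_y (v y + C).
  apply: EFin_inj; rewrite (bmeas_EFin frho measurableT (bmeas_pker m bvC)).
  rewrite (bmeas_EFin kmix_lty measurableT bvC).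
  rewrite (@integral_kcomp _ _ _ _ _ _ R rhoc msnd tt (fun y => (v y + C)%:E)).
  - by apply: eq_integral => x _; rewrite (bmeas_EFin (pker_lty m x) measurableT bvC).
  - by move=> y; rewrite lee_fin; have := vC y; rewrite ler_norml; lra.
  - by apply/measurable_EFinP; case: bvC.
move: H; rewrite (bmeas_RintegralD kmix_lty)//.
under [in RHS]eq_Rintegral do
  rewrite (bmeas_RintegralD (pker_lty m _) measurableT bv bC) pker_Rintegral_cst.
rewrite bmeas_RintegralD//; [|exact: bmeas_pker|exact: bmeas_cst].
by rewrite !Rintegral_cst// kmixT => /addIr.
Qed.

End kernel_mixture.

(** Every point outside the ball has a null open neighbourhood. The complement of the ball is the
    countable union of the compact sets [F k], and each of them is covered by finitely many such
    neighbourhoods. *)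
Lemma msupp_null {R : realType} {X : pmetricType R}
    (m : {measure set (borel X) -> \bar R}) (x : X) (r : R) :
  compact [set: X] -> msupp m `<=` cball x r -> m (~` cball x r) = 0%E.
Proof.
move=> cX mx.
have mB : measurable (cball x r : set (borel X)).
  by apply: borel_closed_measurable; exact: cball_closed.
have Ux y : exists U : set X, ~ cball x r y -> [/\ open U, U y & m U = 0%E].
  have [xy|xy] := pselect (cball x r y); first by exists set0.
  have : ~ msupp m y by move=> /mx.
  move=> /existsNP[U /not_implyP[oU /not_implyP[Uy mU]]]; exists U => _; split => //.
  by apply/eqP; rewrite eq_le measure_ge0 andbT leNgt; apply/negP.
have [U HU] := choice Ux.
pose F (k : nat) := [set y | r + k.+1%:R^-1 <= mdist x y].
have FC k y : F k y -> ~ cball x r y.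
  rewrite /F /cball /= => Fy xy; have := le_trans Fy xy.
  by rewrite gerDl leNgt invr_gt0 ltr0n.
have cF k : compact (F k).
  apply: (subclosed_compact _ cX) => //.
  rewrite (_ : F k = mdist x @^-1` `[r + k.+1%:R^-1, +oo[%classic).
    apply: closed_comp => [y _|]; first exact: mdist_continuous.
    exact: rray_closed.
  by apply/seteqP; split=> y /=; rewrite in_itv/= andbT.
have nF k : m.-negligible (F k : set (borel X)).
  have := cF k; rewrite compact_cover => /(_ X (F k) U).
  case=> [y /FC/HU[]//|y Fy|D DF FD]; first by exists y => //; case: (HU y (FC _ _ Fy)).
  apply: (@negligibleS _ (borel X) R m _ _ FD); rewrite /cover bigcup_fset.
  have : forall y, y \in finmap.enum_fset D -> F k y.
    by move=> y yD; apply: set_mem; exact: DF.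
  elim: (finmap.enum_fset D) => [|y s IH] sF.
    by rewrite big_nil; exact: negligible_set0.
  rewrite big_cons; apply: negligibleU; last first.
    by apply: IH => z zs; apply: sF; rewrite inE zs orbT.
  have Fy : F k y by apply: sF; rewrite inE eqxx.
  have [oU _ mU] := HU _ (FC _ _ Fy).
  by apply/negligibleP => //; exact: borel_open_measurable.
apply: measure_negligible; first exact: measurableC.
apply: (@negligibleS _ (borel X) R m _ _ _ (negligible_bigcup nF)) => y; rewrite /cball /= => /negP.
rewrite -ltNge => ry; have : 0 < mdist x y - r by rewrite subr_gt0.
move=> /ltr_add_invr[k]; rewrite add0r => kd.
by exists k => //; rewrite /F /= -lerBrDl ltW.
Qed.

(** Hides the chosen Hahn decomposition and keeps only a difference of two finite measures. *)
Lemma charge_Rintegral_jordan {R : realType} {d} {T : measurableType d}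
    (nu : {charge set T -> \bar R}) :
  exists a b : {measure set T -> \bar R},
    [/\ (a [set: T] < +oo)%E, (b [set: T] < +oo)%E,
       (forall A, measurable A -> nu A = (a A - b A)%E) &
       forall f : T -> R, charge_Rintegral nu f = \int[a]_x f x - \int[b]_x f x].
Proof.
pose nuPN := svalP (cid (svalP (cid (Hahn_decomposition nu)))).
exists (jordan_pos nuPN), (jordan_neg nuPN); split.
- by rewrite ltey_eq fin_num_measure.
- by rewrite ltey_eq fin_num_measure.
- by move=> A mA; rewrite (jordan_decomp nuPN mA) /cadd /= cscaleN1.
- by [].
Qed.

(** * Labelled measures and the total variation *)

Section kernel_reindex.
Context {R : realType} {d d' d''} {T : measurableType d} {T' : measurableType d'}
  {T'' : measurableType d''}.
Variables (m : R.-pker T' ~> T'') (f : T -> T').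
Hypothesis mf : measurable_fun [set: T] f.

Definition reindex_ker (x : T) : {measure set T'' -> \bar R} := m (f x).

Let mker U : measurable U -> measurable_fun [set: T] (reindex_ker ^~ U).
Proof. by move=> mU; exact: measurableT_comp (measurable_kernel m _ mU) mf. Qed.

HB.instance Definition _ := isKernel.Build _ _ _ _ R reindex_ker mker.

Let ker1 x : reindex_ker x [set: T''] = 1%E. Proof. exact: prob_kernel. Qed.

HB.instance Definition _ := Kernel_isProbability.Build _ _ _ _ R reindex_ker ker1.

Definition reindex_pker : R.-pker T ~> T'' := reindex_ker.

End kernel_reindex.

Lemma eq_measure_Rintegral {R : realType} {d} {T : measurableType d}
    (a b : {measure set T -> \bar R}) (f : T -> R) :
  (forall A, measurable A -> a A = b A) -> \int[a]_x f x = \int[b]_x f x.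
Proof. by move=> ab; congr fine; apply: eq_measure_integral => A mA _; rewrite ab. Qed.

Section labels.
Context {R : realType} {d} {T : measurableType d}.
Variable mu : probability (T * bool)%type R.

Lemma measurable_label (i : bool) : measurable_fun [set: T] (fun x => (x, i)).
Proof. exact: measurable_fun_pair. Qed.

Lemma rho_lty i : (rho_ mu i [set: T] < +oo)%E.
Proof. by rewrite ltey_eq fin_num_measure. Qed.

Lemma bmeas_label i (psi : T * bool -> R) : bmeas psi -> bmeas (fun x => psi (x, i)).
Proof. exact: (bmeas_comp (measurable_label i)). Qed.

(** [mu] is the sum of the images of the [rho_ mu i] under [x |-> (x, i)]. These images are written
    as mixtures of Dirac kernels, so that [Rintegral_kmix] computes their integrals. *)
Lemma Rintegral_labels (psi : T * bool -> R) : bmeas psi ->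
  \int[mu]_w psi w =
  \int[rho_ mu false]_x psi (x, false) + \int[rho_ mu true]_x psi (x, true).
Proof.
move=> bpsi.
pose k i : R.-pker T ~> (T * bool)%type := kdirac (measurable_label i).
pose K i : {measure set (T * bool) -> \bar R} := kmix (rho_ mu i) (k i).
have kE i A : measurable A -> K i A = mu (A `&` ([set: T] `*` [set i])).
  move=> mA; rewrite /K kmixE.
  have mAi : measurable [set x | A (x, i)].
    by rewrite -[X in measurable X]setTI; exact: (measurable_label i).
  transitivity (\int[rho_ mu i]_x (\1_[set x | A (x, i)] x)%:E)%E.
    apply: eq_integral => x _; rewrite /k /kdirac /= diracE indicE.
    by rewrite (_ : (x \in [set x | A (x, i)]) = ((x, i) \in A)).
  rewrite integral_indic// setIT /rho_; congr (mu _).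
  apply/seteqP; split=> [[x j] /= [xA E]|[x j] /= [xA [_ E]]]; by rewrite E in xA *.
have int i : \int[K i]_w psi w = \int[rho_ mu i]_x psi (x, i).
  rewrite /K Rintegral_kmix//; apply: eq_Rintegral => x _.
  rewrite /k /Rintegral /kdirac /= integral_dirac// ?diracT ?mul1e//.
  by apply/measurable_EFinP; case: bpsi.
rewrite -!int -bmeas_Rintegral_add//; [|exact: kmix_lty|exact: kmix_lty].
apply: eq_measure_Rintegral => A mA.
apply: etrans (esym (measure_addE _ _ _)); rewrite !kE// -measureU.
- congr (mu _); apply/seteqP; split=> [[x [|]] xA|w [[]|[]]//].
    by right; split.
  by left; split.
- by apply: measurableI => //; exact: measurableX.
- by apply: measurableI => //; exact: measurableX.
- by apply/seteqP; split=> // -[x j] /= [[_ [_ ->]] [_ [_]]].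
Qed.

Lemma Rintegral_label i (psi : T * bool -> R) : bmeas psi ->
  \int[mu]_(w in [set: T] `*` [set i]) psi w = \int[rho_ mu i]_x psi (x, i).
Proof.
move=> bpsi; set A := _ `*` _.
have mA : measurable A by exact: measurableX.
have E : psi \_ A = (fun w => psi w * \1_A w).
  apply/funext => w; rewrite patchE indicE; case: ifP => _; first by rewrite mulr1.
  by rewrite mulr0.
rewrite Rintegral_mkcond E Rintegral_labels; last first.
  by apply: bmeasM => //; exact: bmeas_indic.
have lab j : \int[rho_ mu j]_x (psi (x, j) * \1_A (x, j)) =
    (i == j)%:R * \int[rho_ mu j]_x psi (x, j).
  rewrite -bmeas_RintegralZ//; [|exact: rho_lty|exact: bmeas_label].
  apply: eq_Rintegral => x _; rewrite mulrC indicE (_ : ((x, j) \in A) = (i == j))//.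
  by apply/idP/eqP => [/set_mem[_ E0]|E0]; [exact: esym|apply/mem_set; split=> //; exact: esym].
by rewrite !lab; case: i @A mA E lab => /=; rewrite mul0r mul1r ?addr0 ?add0r.
Qed.

End labels.

Section TV.
Context {R : realType} {X : pmetricType R}.
Variables (eps : R) (mu : probability (borel X * bool)%type R).
Hypothesis eps0 : 0 < eps.
Hypothesis cX : compact [set: X].
Implicit Types v w : X -> R.

Lemma TVE v : continuous v -> eps * TV eps mu v =
  \int[rho_ mu false]_x ball_max eps v x - \int[rho_ mu false]_x v x +
  (\int[rho_ mu true]_x v x - \int[rho_ mu true]_x ball_min eps v x).
Proof.
move=> cv; have bv := bmeas_continuous cX cv.
have bM := bmeas_ball_max eps0 cX cv; have bm := bmeas_ball_min eps0 cX cv.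
have f0 := rho_lty mu false; have f1 := rho_lty mu true.
rewrite /TV mulrDr -!bmeas_RintegralB//.
rewrite -!bmeas_RintegralZ//; try by under eq_fun do rewrite mulrC; apply: bmeasZ; exact: bmeasB.
by congr (_ + _); apply: eq_Rintegral => x _; rewrite mulrC divfK// gt_eqF.
Qed.

Lemma TV0 : TV eps mu (fun=> 0) = 0.
Proof.
have c0 : continuous (fun _ : X => 0 : R) by exact: cst_continuous.
apply: (mulfI (lt0r_neq0 eps0)); rewrite TVE// mulr0.
have M0 x : ball_max eps (fun _ : X => 0 : R) x = 0.
  by have [y _ [->]] := ball_maxP x eps0 cX c0.
have m0 x : ball_min eps (fun _ : X => 0 : R) x = 0.
  by have [y _ [->]] := ball_minP x eps0 cX c0.
by rewrite (funext M0) (funext m0) !subrr addr0.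
Qed.

Lemma TV_subadd v w : continuous v -> continuous w ->
  TV eps mu (fun x => v x + w x) <= TV eps mu v + TV eps mu w.
Proof.
move=> cv cw; have cvw : continuous (fun x => v x + w x).
  by move=> x; apply: continuousD; [exact: cv|exact: cw].
have bv := bmeas_continuous cX cv; have bw := bmeas_continuous cX cw.
have f0 := rho_lty mu false; have f1 := rho_lty mu true.
suff : eps * TV eps mu (fun x => v x + w x) <= eps * TV eps mu v + eps * TV eps mu w.
  by rewrite -mulrDr ler_pM2l.
rewrite (TVE cvw) (TVE cv) (TVE cw) !bmeas_RintegralD//.
have bMv := bmeas_ball_max eps0 cX cv; have bMw := bmeas_ball_max eps0 cX cw.
have bmv := bmeas_ball_min eps0 cX cv; have bmw := bmeas_ball_min eps0 cX cw.
have H0 : \int[rho_ mu false]_x ball_max eps (fun x => v x + w x) x <=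
    \int[rho_ mu false]_x ball_max eps v x + \int[rho_ mu false]_x ball_max eps w x.
  rewrite -bmeas_RintegralD//; apply: bmeas_le_Rintegral => //.
  - exact: bmeas_ball_max.
  - exact: bmeasD.
  - move=> x _; apply: ball_max_le => // y xy.
    by apply: lerD; exact: ball_max_ge.
have H1 : \int[rho_ mu true]_x ball_min eps v x + \int[rho_ mu true]_x ball_min eps w x <=
    \int[rho_ mu true]_x ball_min eps (fun x => v x + w x) x.
  rewrite -bmeas_RintegralD//; apply: bmeas_le_Rintegral => //.
  - exact: bmeasD.
  - exact: bmeas_ball_min.
  - move=> x _; have [y xy [-> _]] := ball_minP x eps0 cX cvw.
    have [z _ [-> zm]] := ball_minP x eps0 cX cv.
    have [z' _ [-> zm']] := ball_minP x eps0 cX cw.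
    by apply: lerD; [exact: zm|exact: zm'].
have aux (m m1 m2 i1 i2 j1 j2 n n1 n2 : R) : m <= m1 + m2 -> n1 + n2 <= n ->
    m - (i1 + i2) + (j1 + j2 - n) <= m1 - i1 + (j1 - n1) + (m2 - i2 + (j2 - n2)).
  by clear; lra.
exact: aux.
Qed.

End TV.

(** * The divergence as a balance of measures *)

Lemma balance_arith {R : realFieldType} (e a b q0 q1 s0 s1 : R) : 0 < e ->
  a - b = - (e^-1 * (q0 - s0) - e^-1 * (q1 - s1)) <->
  e * a + q0 + s1 = e * b + q1 + s0.
Proof.
move=> e0; have en : e != 0 by rewrite gt_eqF.
split=> H; last by apply: (mulfI en); rewrite mulrN !mulrBr !mulrA divff// !mul1r; lra.
have -> : a = b + (a - b) by rewrite addrC subrK.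
by rewrite H mulrDr mulrN mulrBr !mulrA divff// !mul1r; lra.
Qed.

Section balance.
Context {R : realType} {X : pmetricType R}.
Variables (eps : R) (mu : probability (borel X * bool)%type R).
Hypothesis eps0 : 0 < eps.
Hypothesis cX : compact [set: X].
Variables (m0 m1 : R.-pker (borel X) ~> (borel X)).
Variables (nu : {charge set (borel X) -> \bar R}).
Variables (a b : {measure set (borel X) -> \bar R}).
Hypothesis fa : (a [set: borel X] < +oo)%E.
Hypothesis fb : (b [set: borel X] < +oo)%E.
Hypothesis nuE : forall A, measurable A -> nu A = (a A - b A)%E.

Let r0 : {finite_measure set (borel X) -> \bar R} := rho_ mu false.
Let r1 : {finite_measure set (borel X) -> \bar R} := rho_ mu true.
Let k0 := kmix r0 m0.
Let k1 := kmix r1 m1.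
Let e : {nonneg R} := NngNum (ltW eps0).
(** The equation [nu = - div], multiplied by [eps] and with all negative terms moved across, reads
    [al = be]: an equality between finite positive measures, to which uniqueness through continuous
    functions applies. *)
Let al : {measure set (borel X) -> \bar R} :=
  measure_add (measure_add (mscale e a) r0) k1.
Let be : {measure set (borel X) -> \bar R} :=
  measure_add (measure_add (mscale e b) r1) k0.

Let fine_of (m : {measure set (borel X) -> \bar R}) A : (m [set: borel X] < +oo)%E ->
  measurable A -> exists r, m A = r%:E.
Proof.
move=> fm mA; exists (fine (m A)); rewrite fineK// ge0_fin_numE//.
by apply: le_lt_trans fm; apply: le_measure; rewrite ?inE.
Qed.

Let fr0 : (r0 [set: borel X] < +oo)%E. Proof. exact: rho_lty. Qed.
Let fr1 : (r1 [set: borel X] < +oo)%E. Proof. exact: rho_lty. Qed.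
Let fk0 : (k0 [set: borel X] < +oo)%E. Proof. exact: kmix_lty. Qed.
Let fk1 : (k1 [set: borel X] < +oo)%E. Proof. exact: kmix_lty. Qed.

Let alE A : al A = (eps%:E * a A + r0 A + k1 A)%E. 
Proof. by apply: (etrans (measure_addE _ _ _)); congr (_ + _)%E; exact: measure_addE. Qed.
Let beE A : be A = (eps%:E * b A + r1 A + k0 A)%E. 
Proof. by apply: (etrans (measure_addE _ _ _)); congr (_ + _)%E; exact: measure_addE. Qed.

Let divergenceE (r : {measure set (borel X) -> \bar R})
    (m : R.-pker (borel X) ~> (borel X)) (A : set (borel X)) : measurable A ->
  divergence eps r m A = ((eps^-1)%:E * (r A - \int[r]_x m x A))%E.
Proof.
move=> mA; rewrite /divergence (eq_integral (cst 1%E)).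
  by rewrite integral_cst// mul1e.
by move=> x _; rewrite prob_kernel.
Qed.

Let balance_set A : measurable A ->
  nu A = (- divergence2 eps mu m0 m1 A)%E <-> al A = be A.
Proof.
move=> mA; rewrite alE beE nuE// /divergence2 !divergenceE// -!kmixE -/r0 -/r1 -/k0 -/k1.
have [ra ->] := fine_of fa mA; have [rb ->] := fine_of fb mA.
have [q0 E0] := fine_of fr0 mA; have [q1 E1] := fine_of fr1 mA.
have E0' : rho_ mu false A = q0%:E := E0; have E1' : rho_ mu true A = q1%:E := E1.
have [s0 F0] := fine_of fk0 mA; have [s1 F1] := fine_of fk1 mA.
rewrite ?E0 ?E0' ?E1 ?E1' ?F0 ?F1.
do 3! rewrite -?EFinB -?EFinM -?EFinD -?EFinN.
by split=> -[H]; congr EFin; exact/balance_arith.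
Qed.

Let fal : (al [set: borel X] < +oo)%E.
Proof.
rewrite alE; have [x ->] := fine_of fa measurableT.
have [y ->] := fine_of fr0 measurableT; have [z ->] := fine_of fk1 measurableT.
by rewrite -EFinM -!EFinD ltry.
Qed.

Let fbe : (be [set: borel X] < +oo)%E.
Proof.
rewrite beE; have [x ->] := fine_of fb measurableT.
have [y ->] := fine_of fr1 measurableT; have [z ->] := fine_of fk0 measurableT.
by rewrite -EFinM -!EFinD ltry.
Qed.

Let sum_lty (m m' : {measure set (borel X) -> \bar R}) : (m [set: borel X] < +oo)%E ->
  (m' [set: borel X] < +oo)%E -> (measure_add m m' [set: borel X] < +oo)%E.
Proof.
move=> fm fm'; apply: le_lt_trans (lte_add_pinfty fm fm').
by rewrite le_eqVlt; apply/orP; left; apply/eqP; exact: measure_addE.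
Qed.

Let scale_lty (m : {measure set (borel X) -> \bar R}) : (m [set: borel X] < +oo)%E ->
  (mscale e m [set: borel X] < +oo)%E.
Proof. by move=> fm; rewrite /mscale /= lte_mul_pinfty// lee_fin ltW. Qed.

Let al_int (v : borel X -> R) : bmeas v -> \int[al]_x v x =
  eps * \int[a]_x v x + \int[r0]_x v x + \int[r1]_x \int[m1 x]_y v y.
Proof.
move=> bv; rewrite /al bmeas_Rintegral_add//; last by apply: sum_lty => //; exact: scale_lty.
rewrite bmeas_Rintegral_add//; last exact: scale_lty.
by rewrite bmeas_Rintegral_scale// Rintegral_kmix.
Qed.

Let be_int (v : borel X -> R) : bmeas v -> \int[be]_x v x =
  eps * \int[b]_x v x + \int[r1]_x v x + \int[r0]_x \int[m0 x]_y v y.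
Proof.
move=> bv; rewrite /be bmeas_Rintegral_add//; last by apply: sum_lty => //; exact: scale_lty.
rewrite bmeas_Rintegral_add//; last exact: scale_lty.
by rewrite bmeas_Rintegral_scale// Rintegral_kmix.
Qed.

Lemma divergence_balanceP :
  (forall A : set (borel X), measurable A -> nu A = (- divergence2 eps mu m0 m1 A)%E) <->
  (forall v : X -> R, continuous v ->
    eps * (\int[a]_x v x - \int[b]_x v x) +
      \int[rho_ mu false]_x v x - \int[rho_ mu true]_x v x =
    \int[rho_ mu false]_x \int[m0 x]_y v y - \int[rho_ mu true]_x \int[m1 x]_y v y).
Proof.
split=> [H v cv|H].
  have bv := bmeas_continuous cX cv.
  have : \int[al]_x v x = \int[be]_x v x.
    by apply: eq_measure_Rintegral => A mA; apply/balance_set => //; exact: H.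
  rewrite al_int// be_int// mulrBr => E; apply/eqP; rewrite -subr_eq0; apply/eqP.
  by move/eqP: E; rewrite -subr_eq0 => /eqP <-; rewrite /r0 /r1; ring.
move=> A mA; apply/balance_set => //; apply: (eq_measure_continuous cX) => // v cv.
have bv := bmeas_continuous cX cv.
rewrite al_int// be_int//; move/eqP: (H v cv); rewrite -subr_eq0 mulrBr => /eqP E.
by apply/eqP; rewrite -subr_eq0; apply/eqP; rewrite -E /r0 /r1; ring.
Qed.

End balance.

(** * The subdifferential *)

Lemma random_walk_compact {R : realType} {X : pmetricType R}
    (m : R.-pker (borel X) ~> (borel X)) : compact [set: X] -> random_walk m.
Proof.
move=> cX; exists point => x.
have bd := bmeas_continuous cX (@mdist_continuous _ _ (point : X)).
by rewrite -(bmeas_EFin (pker_lty m x) measurableT bd) ltry.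
Qed.

Lemma pker_Rintegral_le {R : realType} {d} {T : measurableType d}
    {X : pmetricType R} (m : R.-pker T ~> borel X) w (F : set X) (v : X -> R) r :
  bmeas (v : borel X -> R) -> closed F -> m w (~` F) = 0%E ->
  (forall y, F y -> v y <= r) -> \int[m w]_y v y <= r.
Proof.
move=> bv cF mF vr; rewrite -[leRHS](pker_Rintegral_cst m w).
apply: bmeas_le_Rintegral_ae => //; [exact: pker_lty|exact: bmeas_cst|].
exists (~` F); split => //.
  by apply: measurableC; exact: borel_closed_measurable.
by move=> y /= H Fy; apply: H => _; exact: vr.
Qed.

Lemma TV_arith {R : realFieldType} (l i0 i1 M m : R) :
  l <= M - i0 + (i1 - m) <-> l + i0 - i1 <= M - m.
Proof. by split; lra. Qed.

Section proposition.
Context {R : realType} {X : pmetricType R}.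
Variables (eps : R) (mu : probability (borel X * bool)%type R) (u : X -> R)
  (nu : {charge set (borel X) -> \bar R}).
Hypothesis eps0 : 0 < eps.
Hypothesis cX : compact [set: X].
Hypothesis cu : continuous u.

Let L (v : X -> R) := charge_Rintegral nu (v : borel X -> R).

Lemma charge_RintegralD (v w : X -> R) : continuous v -> continuous w ->
  L (fun x => v x + w x) = L v + L w.
Proof.
move=> cv cw; have [a [b [fa fb _ LE]]] := charge_Rintegral_jordan nu.
have bv := bmeas_continuous cX cv; have bw := bmeas_continuous cX cw.
rewrite /L !LE !bmeas_RintegralD// opprD addrACA.
by [].
Qed.

Lemma charge_RintegralZ r (v : X -> R) : continuous v -> L (fun x => r * v x) = r * L v.
Proof.
move=> cv; have [a [b [fa fb _ LE]]] := charge_Rintegral_jordan nu.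
have bv := bmeas_continuous cX cv.
by rewrite /L !LE !bmeas_RintegralZ// mulrBr.
Qed.

Lemma charge_RintegralB (v w : X -> R) : continuous v -> continuous w ->
  L (fun x => v x - w x) = L v - L w.
Proof.
move=> cv cw; rewrite -mulN1r -charge_RintegralZ// -charge_RintegralD//.
  by congr L; apply/funext => x; rewrite mulN1r.
by move=> x; apply: (@continuousM R X (cst (-1)) w); [exact: cst_continuous|exact: cw].
Qed.

(** Testing at [u + v] and subadditivity give [L v <= TV v], since the terms in [u] cancel; testing
    at 0, where TV is 0, gives the remaining inequality [TV u <= L u]. *)
Lemma subdifferential_TVP : subdifferential (TV eps mu) u nu <->
  TV eps mu u = L u /\ forall v : X -> R, continuous v -> L v <= TV eps mu v.
Proof.
split=> [sub|[TVu LTV] v cv]; last first.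
  by rewrite -/(L _) charge_RintegralB// TVu addrC subrK LTV.
have add (v : X -> R) : continuous v -> TV eps mu u + L v <= TV eps mu (fun x => u x + v x).
  move=> cv; have cuv : continuous (fun x => u x + v x).
    by move=> x; apply: continuousD; [exact: cu|exact: cv].
  have := sub _ cuv; rewrite -/(L _).
  by under [in L _]eq_fun do rewrite addrAC subrr add0r.
have LTV (v : X -> R) : continuous v -> L v <= TV eps mu v.
  move=> cv; have := add _ cv; have := TV_subadd mu eps0 cX cu cv.
  by move=> H1 H2; have := le_trans H2 H1; rewrite lerD2l.
split=> //; apply/eqP; rewrite eq_le LTV// andbT.
have c0 : continuous (fun _ : X => 0 : R) by exact: cst_continuous.
have := sub _ c0; rewrite -/(L _) charge_RintegralB// TV0//.
have -> : L (fun=> 0) = 0.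
  rewrite -[RHS](mul0r (L (fun=> 0))) -charge_RintegralZ//.
  by congr L; apply/funext => x; rewrite mul0r.
by rewrite sub0r subr_le0.
Qed.

(** After multiplication by [eps], the bound by TV says that [M v] is at most the integral of the
    ball maximum minus that of the ball minimum. An admissible [psi] in [strassen_signed] exceeds
    the ball maximum of [v] at label 0 and minus the ball minimum at label 1, so its integral is
    larger still. *)
Lemma walks_of_dominated : (forall v : X -> R, continuous v -> L v <= TV eps mu v) ->
  exists m0 m1 : R.-pker (borel X) ~> (borel X),
    [/\ forall x, m0 x (~` cball (x : X) eps) = 0%E,
        forall x, m1 x (~` cball (x : X) eps) = 0%E &
        forall v : X -> R, continuous v ->
          eps * L v + \int[rho_ mu false]_x v x - \int[rho_ mu true]_x v x =
          \int[rho_ mu false]_x \int[m0 x]_y v y -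
          \int[rho_ mu true]_x \int[m1 x]_y v y].
Proof.
move=> LTV.
pose M (v : X -> R) := eps * L v + \int[rho_ mu false]_x v x - \int[rho_ mu true]_x v x.
have f0 := rho_lty mu false; have f1 := rho_lty mu true.
have ML (v : X -> R) : continuous v -> M v <=
    \int[rho_ mu false]_x ball_max eps v x - \int[rho_ mu true]_x ball_min eps v x.
  move=> cv; have := LTV _ cv; rewrite -(ler_pM2l eps0) (TVE mu eps0 cX cv).
  by move=> /TV_arith.
pose A i : set (borel X * bool) := [set: borel X] `*` [set i].
have mA i : measurable (A i) by exact: measurableX.
have A1 (x : borel X) i j : \1_(A i) (x, j) = (i == j)%:R :> R.
  rewrite indicE (_ : ((x, j) \in A i) = (i == j))//.
  by apply/idP/eqP => [/set_mem[_ E0]|E0]; [exact: esym|apply/mem_set; split=> //; exact: esym].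
have [|||m [mball mM]] := @strassen_signed R _ (borel X * bool)%type X mu fst eps
    (A false) (A true) M cX measurable_fst (ltW eps0) (mA false) (mA true).
- move=> v w cv cw; have bv := bmeas_continuous cX cv; have bw := bmeas_continuous cX cw.
  by rewrite /M charge_RintegralD// !bmeas_RintegralD//; ring.
- move=> r v cv; have bv := bmeas_continuous cX cv.
  by rewrite /M charge_RintegralZ// !bmeas_RintegralZ//; ring.
- move=> v psi cv bpsi H; apply: le_trans (ML v cv) _.
  rewrite Rintegral_labels//.
  have bM := bmeas_ball_max eps0 cX cv; have bm := bmeas_ball_min eps0 cX cv.
  apply: lerD.
    apply: bmeas_le_Rintegral => //; first exact: bmeas_label.
    move=> x _; apply: ball_max_le => // y xy.
    by have := H (x, false) y xy; rewrite !A1 /= subr0 mul1r.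
  rewrite -bmeas_RintegralN//.
  apply: bmeas_le_Rintegral => //; [exact: bmeasN|exact: bmeas_label|].
  move=> x _; have [y xy [-> _]] := ball_minP x eps0 cX cv.
  by have := H (x, true) y xy; rewrite !A1 /= sub0r mulN1r.
exists (reindex_pker m (measurable_label false)), (reindex_pker m (measurable_label true)).
split=> [x|x|v cv].
- exact: (mball (x, false)).
- exact: (mball (x, true)).
- have bK := bmeas_pker m (bmeas_continuous cX cv).
  by rewrite -/(M v) mM// /A !Rintegral_label.
Qed.

Lemma walk_integral_le (m0 m1 : R.-pker (borel X) ~> (borel X)) (v : X -> R) :
  (\forall x \ae rho mu,
    msupp (m0 x) `<=` cball x eps /\ msupp (m1 x) `<=` cball x eps) ->
  continuous v ->
  \int[rho_ mu false]_x \int[m0 x]_y v y - \int[rho_ mu true]_x \int[m1 x]_y v y <=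
  \int[rho_ mu false]_x ball_max eps v x - \int[rho_ mu true]_x ball_min eps v x.
Proof.
move=> [N [mN muN0 goodN]] cv.
(* A null set of the sum is null for both summands, so the support condition may be used under
   either integral. *)
have [N0 N1] : rho_ mu false N = 0%E /\ rho_ mu true N = 0%E.
  move: muN0; rewrite /rho measure_addE => /eqP.
  by rewrite padde_eq0// => /andP[/eqP -> /eqP ->].
have bv := bmeas_continuous cX cv.
have f0 := rho_lty mu false; have f1 := rho_lty mu true.
have bM := bmeas_ball_max eps0 cX cv; have bm := bmeas_ball_min eps0 cX cv.
apply: lerB.
  apply: bmeas_le_Rintegral_ae => //; first exact: bmeas_pker.
  exists N; split=> // x /= H; apply: goodN => /= -[s0 _]; apply: H => _.
  apply: (pker_Rintegral_le bv (@cball_closed _ _ x eps)) => //.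
    exact: msupp_null.
  by move=> y xy; exact: ball_max_ge.
apply: bmeas_le_Rintegral_ae => //; first exact: bmeas_pker.
exists N; split=> // x /= H; apply: goodN => /= -[_ s1]; apply: H => _.
rewrite -lerN2 -bmeas_RintegralN//; last exact: pker_lty.
apply: (pker_Rintegral_le (bmeasN bv) (@cball_closed _ _ x eps)) => //.
  exact: msupp_null.
move=> y xy; rewrite lerN2; have [z _ [-> zm]] := ball_minP x eps0 cX cv.
exact: zm.
Qed.

End proposition.

Lemma null_msupp {R : realType} {X : pmetricType R}
    (m : {measure set (borel X) -> \bar R}) (F : set X) :
  closed F -> m (~` F) = 0%E -> msupp m `<=` F.
Proof.
move=> cF mF y ym; apply: contrapT => Fy.
by have := ym _ (closed_openC cF) Fy; rewrite mF ltxx.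
Qed.

Theorem proposition2p18 (R : realType) (X : pmetricType R) (eps : R)
    (mu : probability (borel X * bool)%type R) (u : X -> R)
    (mustar : {charge set (borel X) -> \bar R}) :
  0 < eps -> compact [set: X] -> shrinking X eps -> continuous u ->
  subdifferential (TV eps mu) u mustar <->
  exists m0 m1 : R.-pker (borel X) ~> (borel X),
    [/\ random_walk m0 /\ random_walk m1,
        \forall x \ae rho mu,
          msupp (m0 x) `<=` cball x eps /\ msupp (m1 x) `<=` cball x eps,
        forall A : set (borel X), measurable A ->
          mustar A = (- divergence2 eps mu m0 m1 A)%E &
        TV eps mu u = charge_Rintegral mustar (u : borel X -> R)].
Proof.
move=> eps0 cX _ cu.
have [a [b [fa fb nuE LE]]] := charge_Rintegral_jordan mustar.
apply: (iff_trans (subdifferential_TVP _ _ eps0 cX cu)).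
split=> [[TVu LTV]|[m0 [m1 [_ msuppB divE TVu]]]].
  have [m0 [m1 [m0B m1B mL]]] := walks_of_dominated eps0 cX LTV.
  exists m0, m1; split=> //.
  - by split; exact: random_walk_compact.
  - by apply: aeW => x; split; apply: null_msupp => //; exact: cball_closed.
  - apply/(divergence_balanceP _ eps0 cX _ _ fa fb nuE) => v cv.
    by rewrite -LE mL.
(* For the converse, the balance identity turns the left side of the domination into the walk
   integrals, and these are bounded by the ball extrema because of the supports. *)
split=> // v cv.
have := (divergence_balanceP _ eps0 cX _ _ fa fb nuE).1 divE v cv.
have := walk_integral_le eps0 cX msuppB cv.
move=> H E; rewrite -E in H.
rewrite -(ler_pM2l eps0) (TVE mu eps0 cX cv) LE.
exact/TV_arith.
Qed.
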